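(* Let $G$ be a graph with $n$ vertices, with adjacency matrix $A$ and graph Laplacian matrix $L$, and let $0<p<1$. Suppose that (i) $\|\Delta_A\|/(np)<1/12$, (ii) $\|\Delta_L\|/(np)<1/4$, and (iii) $$\frac{\pi/4}{\sin^{-1}\!\left(\frac{12\|\Delta_A\|}{np}\right)}>\frac{\log(n/6)}{\log\!\left(\frac{np}{2\|\Delta_L\|}-1\right)}+1 .$$ Then the only stable equilibrium of the Kuramoto system $$\frac{d\theta_j}{dt}=\sum_{k=1}^n A_{jk}\sin(\theta_k-\theta_j),\qquad 1\le j\le n,$$ is the all-in-phase state.
   Context: Graphs are finite and undirected, self-loops allowed; the adjacency matrix $A$ is a symmetric $n\times n$ matrix with entries in $\{0,1\}$. $L=D-A$, where $D$ is diagonal with $D_{jj}=\sum_k A_{jk}$ the degree of vertex $j$ (counting self-loops). $J_n$ is the $n\times n$ all-ones matrix, $I_n$ the identity, and $$\Delta_A=A-pJ_n,\qquad \Delta_L=L+pJ_n-npI_n .$$ $\|\cdot\|$ is the spectral norm of a symmetric matrix (the largest absolute value of an eigenvalue). $\log$ is the natural logarithm. Phases $\theta_j$ are taken modulo $2\pi$. An equilibrium is a $\theta=(\theta_1,\dots,\theta_n)$ at which all right-hand sides of the system vanish; ''stable'' is meant in the standard (Lyapunov) sense. The all-in-phase state is the state in which all $\theta_j$ are equal modulo $2\pi$ (unique up to a global shift of all phases). In hypothesis (iii) the denominators are understood to be nonzero. *)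

(* Defs.v *)
From mathcomp Require Import all_boot all_order all_algebra.
From mathcomp Require Import all_classical all_reals all_analysis.

Set Implicit Arguments.
Unset Strict Implicit.
Unset Printing Implicit Defensive.

Import Order.TTheory GRing.Theory Num.Theory.
Import numFieldNormedType.Exports.

Local Open Scope classical_set_scope.
Local Open Scope ring_scope.

(* A graph on the vertices 'I_n is a symmetric relation, not assumed to be
   irreflexive: self-loops are allowed. *)

Definition adjmx (R : realType) (n : nat) (e : rel 'I_n) : 'M[R]_n :=
  \matrix_(j, k) (e j k)%:R.

Definition lapmx (R : realType) (n : nat) (A : 'M[R]_n) : 'M[R]_n :=
  diag_mx (\row_j \sum_(k < n) A j k) - A.

(* For a symmetric M the set of eigenvalues is finite, and nonempty if 0 < n,
   so this supremum is a maximum. *)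
Definition spectral_norm (R : realType) (n : nat) (M : 'M[R]_n) : R :=
  sup [set `|a| | a in [set a : R | eigenvalue M a]].

Definition DeltaA (R : realType) (n : nat) (p : R) (A : 'M[R]_n) : 'M[R]_n :=
  A - p *: const_mx 1.

Definition DeltaL (R : realType) (n : nat) (p : R) (L : 'M[R]_n) : 'M[R]_n :=
  L + p *: const_mx 1 - (n%:R * p)%:M.

(* Phases are represented by real numbers; equality and proximity of phases
   are taken modulo 2 pi. *)

Definition kuramoto (R : realType) (n : nat) (A : 'M[R]_n)
    (theta : 'I_n -> R) (j : 'I_n) : R :=
  \sum_(k < n) A j k * sin (theta k - theta j).

Definition kuramoto_solution (R : realType) (n : nat) (A : 'M[R]_n)
    (x : R -> 'I_n -> R) : Prop :=
  forall j : 'I_n,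
    {within `[0, +oo[, continuous (fun t : R => x t j)} /\
    forall t : R, 0 < t ->
      is_derive t (1 : R) (fun s : R => x s j) (kuramoto A (x t) j).

Definition equilibrium (R : realType) (n : nat) (A : 'M[R]_n)
    (theta : 'I_n -> R) : Prop :=
  forall j : 'I_n, kuramoto A theta j = 0.

Definition phase_close (R : realType) (n : nat) (eps : R)
    (theta phi : 'I_n -> R) : Prop :=
  forall j : 'I_n, exists m : int,
    `|theta j - phi j - m%:~R * (2 * pi)| < eps.

(* The vector field is bounded and smooth, so every initial state has a
   solution on [0, +oo[ and quantifying over such solutions is the usual
   notion of Lyapunov stability. *)
Definition lyapunov_stable (R : realType) (n : nat) (A : 'M[R]_n)
    (theta : 'I_n -> R) : Prop :=
  forall eps : R, 0 < eps -> exists2 delta : R, 0 < delta &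
    forall x : R -> 'I_n -> R, kuramoto_solution A x ->
      phase_close delta (x 0) theta ->
      forall t : R, 0 <= t -> phase_close eps (x t) theta.

Definition all_in_phase (R : realType) (n : nat) (theta : 'I_n -> R) : Prop :=
  forall j k : 'I_n, exists m : int, theta j - theta k = m%:~R * (2 * pi).

(* Main.v *)
Require Import Defs.
From mathcomp Require Import all_boot all_order all_algebra.
From mathcomp Require Import all_classical all_reals all_analysis.
From mathcomp Require Import ring lra.

Set Implicit Arguments.
Unset Strict Implicit.
Unset Printing Implicit Defensive.

Import Order.TTheory GRing.Theory Num.Theory.
Import numFieldNormedType.Exports.

Local Open Scope ring_scope.

(** The system is the gradient flow of the energy whose Hessian at [theta] is
    the Laplacian [H] of the matrix with entries
    [A j k * cos (theta k - theta j)].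

    The in-phase state is stable because, once the phases are lifted to real
    numbers [u j] close to a common value, the sum of the [u j ^+ 2] does not
    increase: its derivative is a sum of terms
    [- A j k * (u j - u k) * sin (u j - u k)]  (all_in_phase_stable).

    Conversely, let [theta] be a stable equilibrium.  Then [H] is positive
    semidefinite (stable_curvature).  Otherwise some [s > 0] makes
    [B = H + s] nonsingular and still negative somewhere, and along a solution
    [theta + u] that stays close to [theta] the function [V = - u^T B u]
    satisfies [V' >= 2 s V], since [V' - 2 s V] is [2 |B u|^2] up to a term of
    third order.  Started at a point with [V > 0], [V] grows exponentially,
    which contradicts stability.  The solution that is needed comes from Picard
    iteration (ode_exists).

    It remains to see that an equilibrium with [H >= 0] is in phase.  Write
    [z j] for the unit complex number of phase [theta j], rotate so that the
    sum [r] of the [z j] is real and nonnegative, and let [q] be the image of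
    [z] under [DeltaA].  Testing [H >= 0] on the real and imaginary parts of
    [z] gives [r ^+ 2 >= n ^+ 2 / 3].  Testing it on one vertex, together with
    the equilibrium equation, gives [(A z) j = w j * z j] with [w j >= 0]; so
    [z j] has the direction of [p * r + q j], and a phase outside
    [[- b, b]] costs [|q j| >= p * r * sin b].  As the squares [|q j| ^+ 2] add
    up to at most [|DeltaA| ^+ 2 * n], few phases are far from 0
    (card_far_chebyshev).

    This is amplified as follows (far_step).  Let [sin alpha] be
    [12 * |DeltaA| / (n * p)], let [C] be the set of vertices with phase outside
    [[- b, b]], and let [S] be those with phase outside
    [[- (b + alpha), b + alpha]].  For [j] in [S] the component of
    [(A z) j] normal to the ray of angle [b + alpha] points outwards, while
    every neighbour outside [C] contributes at least [sin alpha] inwards.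
    Hence the edges from [S] to the complement of [C] have to be balanced by the
    edges inside [S]; [DeltaA] bounds the latter from above and [DeltaL] bounds
    the former from below, unless [C] is larger than [S] by the factor
    [g = n * p / (2 * |DeltaL|) - 1].  There is room for about
    [(pi / 2) / alpha] such steps before the angle reaches [pi / 2], and the
    last hypothesis says that this is enough to leave less than one vertex
    (far_eventually_empty).

    So all phases lie in an open half circle.  With [t j = tan (theta j)] the
    equilibrium equations, multiplied by [t j] and summed, say that
    [A j k * cos (theta j) * cos (theta k) * (t j - t k) ^+ 2] sums to 0.  Thus
    [t] is in the kernel of the Laplacian of the graph, which consists of the
    constants because [|DeltaL| < n * p] (in_phase_of_cos_gt0). *)

(** * Symmetric matrices and their spectral norm *)

Section LinearAlgebra.
Variables (R : realType) (n : nat).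
Implicit Types (x y z : 'I_n -> R) (M N : 'M[R]_n).

(** Vectors are functions on ['I_n], as phases are, rather than column matrices. *)
Definition dot x y : R := \sum_j x j * y j.
Definition mxapp M x : 'I_n -> R := fun j => \sum_k M j k * x k.
Definition form M x y : R := dot x (mxapp M y).

Lemma formE M x y : form M x y = \sum_j \sum_k x j * M j k * y k.
Proof.
by apply: eq_bigr => j _; rewrite mulr_sumr; apply: eq_bigr => k _; rewrite mulrA.
Qed.

Lemma dotC x y : dot x y = dot y x.
Proof. by apply: eq_bigr => j _; rewrite mulrC. Qed.

Lemma dotDr x y z : dot x (y \+ z) = dot x y + dot x z.
Proof. by rewrite -big_split; apply: eq_bigr => j _; rewrite mulrDr. Qed.

Lemma dotZr (a : R) x y : dot x (a \*o y) = a * dot x y.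
Proof. by rewrite mulr_sumr; apply: eq_bigr => j _; rewrite mulrCA. Qed.

Lemma dotBr x y z : dot x (y \- z) = dot x y - dot x z.
Proof. by rewrite -sumrB; apply: eq_bigr => j _; rewrite mulrBr. Qed.

Lemma dot_ge0 x : 0 <= dot x x.
Proof. by apply: sumr_ge0 => j _; rewrite -expr2 sqr_ge0. Qed.

Lemma sqr_le_dot x j : x j ^+ 2 <= dot x x.
Proof.
rewrite /dot (bigD1 j)//= -expr2 lerDl.
by apply: sumr_ge0 => k _; rewrite -expr2 sqr_ge0.
Qed.

Lemma dot_eq0 x : dot x x = 0 -> forall j, x j = 0.
Proof.
by move=> x0 j; apply/eqP; rewrite -sqrf_eq0 eq_le sqr_ge0 -x0 sqr_le_dot.
Qed.

Lemma mxappD M x y : mxapp M (x \+ y) = mxapp M x \+ mxapp M y.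
Proof. by apply/funext => j; rewrite /= -big_split; apply: eq_bigr => k _; rewrite mulrDr. Qed.

Lemma mxappZ M (a : R) x : mxapp M (a \*o x) = a \*o mxapp M x.
Proof. by apply/funext => j; rewrite /= mulr_sumr; apply: eq_bigr => k _; rewrite mulrCA. Qed.

Lemma sym_entry M j k : M^T = M -> M j k = M k j.
Proof. by move=> sM; rewrite -{1}sM mxE. Qed.

Lemma formC M x y : M^T = M -> form M x y = form M y x.
Proof.
move=> sM; rewrite !formE exchange_big; apply: eq_bigr => j _; apply: eq_bigr => k _.
by rewrite -{1}sM mxE; ring.
Qed.

Lemma mxappDM M N x : mxapp (M + N) x = mxapp M x \+ mxapp N x.
Proof.
apply/funext => j; rewrite /= -big_split; apply: eq_bigr => k _.
by rewrite mxE mulrDl.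
Qed.

Lemma formDM M N x y : form (M + N) x y = form M x y + form N x y.
Proof. by rewrite /form mxappDM dotDr. Qed.

Lemma formNM M x y : form (- M) x y = - form M x y.
Proof.
rewrite !formE -sumrN; apply: eq_bigr => j _; rewrite -sumrN.
by apply: eq_bigr => k _; rewrite mxE /=; ring.
Qed.

Lemma mxapp_scalar (a : R) x : mxapp a%:M x = a \*o x.
Proof.
apply/funext => j; rewrite /mxapp (bigD1 j)//= mxE eqxx mulr1n big1 ?addr0// => k kj.
by rewrite mxE eq_sym (negbTE kj) mulr0n mul0r.
Qed.

Lemma form_scalar (a : R) x y : form a%:M x y = a * dot x y.
Proof. by rewrite /form mxapp_scalar dotZr. Qed.

Lemma formDr M x y z : form M x (y \+ z) = form M x y + form M x z.
Proof. by rewrite /form mxappD dotDr. Qed.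

Lemma formZr M (a : R) x y : form M x (a \*o y) = a * form M x y.
Proof. by rewrite /form mxappZ dotZr. Qed.

Lemma form_expand M x y (t : R) : M^T = M ->
  form M (x \+ (t \*o y)) (x \+ (t \*o y)) =
  form M x x + 2 * t * form M x y + t ^+ 2 * form M y y.
Proof.
move=> sM; rewrite formDr formZr [form M _ x]formC// [form M _ y]formC//.
by rewrite !formDr !formZr [form M y x]formC//; ring.
Qed.

(** If [c > 0], the claim is the hypothesis at the minimum [t = - b / c].  If
    [c <= 0], the polynomial is bounded below only when [c = 0] and [b = 0]. *)
Lemma discriminant (a b c : R) :
  0 <= a -> (forall t, 0 <= a + 2 * t * b + t ^+ 2 * c) -> b ^+ 2 <= a * c.
Proof.
move=> a0 H; have [c0|c0] := ltP 0 c.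
  have := H (- b / c).
  have -> : a + 2 * (- b / c) * b + (- b / c) ^+ 2 * c = (a * c - b ^+ 2) / c.
    by field; rewrite gt_eqF.
  by rewrite pmulr_lge0 ?invr_gt0// subr_ge0.
have {}c0 : c = 0.
  apply/eqP; rewrite eq_le c0 /=.
  rewrite leNgt; apply/negP => cn.
  (* A value of [t] so large that the negative leading term wins. *)
  have := H ((2 * `|b| + a + 1) / - c + 1).
  set d := - c; have d0 : 0 < d by rewrite oppr_gt0.
  have -> : c = - d by rewrite opprK.
  set u := (2 * `|b| + a + 1) / d.
  have u0 : 0 <= u by apply: divr_ge0; [rewrite !addr_ge0// mulr_ge0|rewrite ltW].
  have ud : u * d = 2 * `|b| + a + 1 by rewrite /u divfK ?gt_eqF.
  have bb := ler_norm b.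
  rewrite leNgt => /negP; apply.
  have -> : (u + 1) ^+ 2 * - d = - ((u * d) * (u + 2) + d) by ring.
  rewrite ud; have b0 := normr_ge0 b.
have : (u + 1) * b <= (u + 1) * `|b| by rewrite ler_wpM2l// addr_ge0.
have ub : 0 <= u * `|b| by exact: mulr_ge0.
have ua : 0 <= u * a by exact: mulr_ge0.
lra.
rewrite c0 mulr0 -[b ^+ 2]/(b ^+ 2).
have [->|b0] := eqVneq b 0; first by rewrite expr0n.
have := H (- (a + 1) / b).
rewrite c0 mulr0 addr0 -mulrA divfK//; lra.
Qed.

Lemma mxapp_lapmx M x j : mxapp (lapmx M) x j = \sum_k M j k * (x j - x k).
Proof.
rewrite /mxapp /lapmx (eq_bigr (fun k => (diag_mx (\row_j0 \sum_(k0 < n) M j0 k0)) j k * x k - M j k * x k)); last first.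
  by move=> k _; rewrite !mxE; ring.
rewrite sumrB (bigD1 j)//= big1 ?addr0; last first.
  by move=> k kj; rewrite !mxE eq_sym (negbTE kj) mulr0n mul0r.
rewrite !mxE eqxx mulr1n mulr_suml -sumrB; apply: eq_bigr => k _; ring.
Qed.

Lemma lapmx_sym M : M^T = M -> (lapmx M)^T = lapmx M.
Proof.
move=> sM; apply/matrixP => j k; rewrite !mxE (sym_entry k j sM) (eq_sym k j).
by case: eqVneq => [->|//]; rewrite ?mulr0n.
Qed.

Definition psd M := M^T = M /\ forall x, 0 <= form M x x.

Lemma psd_cauchy_schwarz M x y : psd M ->
  form M x y ^+ 2 <= form M x x * form M y y.
Proof.
by move=> [sM pM]; apply: discriminant => // t; rewrite -form_expand.
Qed.

Lemma psd1 : psd 1%:M.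
Proof. by split; [rewrite trmx1 | move=> x; rewrite form_scalar mul1r dot_ge0]. Qed.

Lemma cauchy_schwarz x y : dot x y ^+ 2 <= dot x x * dot y y.
Proof. by have := psd_cauchy_schwarz x y psd1; rewrite !form_scalar !mul1r. Qed.

Lemma mxapp_bounded M : exists2 K : R, 0 <= K & forall x, dot (mxapp M x) (mxapp M x) <= K * dot x x.
Proof.
exists (\sum_j dot (M j) (M j)); first by apply: sumr_ge0 => j _; apply: dot_ge0.
move=> x; rewrite /dot mulr_suml; apply: ler_sum => j _.
by rewrite -expr2; apply: cauchy_schwarz.
Qed.

Lemma mxapp_mulmx M x : mxapp M x = fun j => (M *m \col_k x k) j 0.
Proof. by apply/funext => j; rewrite mxE; apply: eq_bigr => k _; rewrite mxE. Qed.

(** The inverse matrix is bounded, so a nonsingular matrix is bounded below. *)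
Lemma unitmx_lower_bound M : M \in unitmx ->
  exists2 K : R, 0 <= K & forall x, dot x x <= K * dot (mxapp M x) (mxapp M x).
Proof.
move=> uM; have [K K0 HK] := mxapp_bounded (invmx M).
exists K => // x; rewrite -[in dot x x](_ : mxapp (invmx M) (mxapp M x) = x) ?HK//.
apply/funext => j; rewrite !mxapp_mulmx.
suff -> : \col_k (M *m \col_k0 x k0) k 0 = M *m \col_k0 x k0.
  by rewrite mulKmx// mxE.
by apply/matrixP => i k; rewrite mxE ord1.
Qed.

Lemma nonunit_eigenvalue M (a : R) : M^T = M -> a%:M - M \notin unitmx -> eigenvalue M a.
Proof.
move=> sM nu; rewrite /eigenvalue /eigenspace kermx_eq0.
by rewrite row_free_unit -opprB -scaleN1r unitmxZ ?unitrN1.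
Qed.

Lemma dot_le_half x y : dot x y <= (dot x x + dot y y) / 2.
Proof.
have := dot_ge0 (x \- y); rewrite dotBr dotC dotBr [dot (x \- y) y]dotC dotBr.
rewrite (dotC y x); lra.
Qed.

Lemma form_upper M : exists2 K : R, 0 <= K & forall x, form M x x <= K * dot x x.
Proof.
have [K K0 HK] := mxapp_bounded M; exists ((1 + K) / 2); first lra.
move=> x; apply: (le_trans (dot_le_half _ _)); have := HK x; lra.
Qed.

(** For a semidefinite [N] the Cauchy-Schwarz inequality bounds [|N x| ^+ 2] by a
    multiple of [form N x x], and if [N] is moreover nonsingular then [|N x|]
    controls [|x|]. *)
Lemma psd_unit_coercive N : psd N -> N \in unitmx ->
  exists2 K : R, 0 < K & forall x, dot x x <= K * form N x x.
Proof.
move=> pN uN; have [K1 K10 H1] := unitmx_lower_bound uN.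
have [K2 K20 H2] := form_upper N.
exists (K1 * K2 + 1); first by rewrite ltr_wpDl// mulr_ge0.
move=> x; set f := form N x x; have f0 : 0 <= f by exact: pN.2.
set d := dot (mxapp N x) (mxapp N x); have d0 : 0 <= d by exact: dot_ge0.
have dK : d <= K2 * f.
  have := psd_cauchy_schwarz x (mxapp N x) pN.
  rewrite formC ?pN.1// -/(dot _ _) -/d -/f => dd.
  have := H2 (mxapp N x); rewrite -/d => gd.
  have [->|dn] := eqVneq d 0; first exact: mulr_ge0.
  have dp : 0 < d by rewrite lt_def dn.
  rewrite -(ler_pM2r dp) -expr2 (le_trans dd)// mulrC -mulrA mulrCA.
  by rewrite mulrCA [f * d]mulrC mulrA ler_wpM2r.
have := H1 x; rewrite -/d; have : K1 * d <= K1 * (K2 * f) by rewrite ler_wpM2l.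
lra.
Qed.

(** The supremum [l] of the Rayleigh quotient is an eigenvalue, without any
    compactness argument: [l - M] is semidefinite, and if it were nonsingular it
    would be coercive, so that a smaller number would still bound the quotient. *)
Lemma rayleigh_max M : M^T = M -> (0 < n)%N ->
  exists2 l : R, eigenvalue M l & forall x, form M x x <= l * dot x x.
Proof.
move=> sM n0.
pose S := [set form M x x / dot x x | x in [set x | dot x x != 0]]%classic.
have [K K0 HK] := form_upper M.
have dp x : dot x x != 0 -> 0 < dot x x by move=> x0; rewrite lt_def x0 dot_ge0.
have ubS : ubound S K.
  by move=> _ [x /= x0 <-]; rewrite ler_pdivrMr ?dp.
have S0 : (S !=set0)%classic.
  exists (form M (fun=> 1) (fun=> 1) / dot (fun=> 1) (fun=> 1)), (fun=> 1) => //=.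
  rewrite /dot (eq_bigr (fun=> 1)) ?sumr_const ?card_ord ?pnatr_eq0 -?lt0n//.
  by move=> j _; rewrite mulr1.
have supS : has_sup S by split => //; exists K.
pose l := sup S; have lP x : form M x x <= l * dot x x.
  have [x0|x0] := eqVneq (dot x x) 0; last first.
    by rewrite -ler_pdivrMr ?dp//; apply: ub_le_sup; [exists K|exists x].
  rewrite x0 mulr0 /form /dot big1// => j _.
  by rewrite (dot_eq0 x0) mul0r.
exists l => //; apply: nonunit_eigenvalue => //; apply/negP => uN.
have fN x : form (l%:M - M) x x = l * dot x x - form M x x.
  by rewrite formDM formNM form_scalar.
have pN : psd (l%:M - M).
  split; first by rewrite linearB /= sM tr_scalar_mx.
  by move=> x; rewrite fN subr_ge0.
have [C C0 HC] := psd_unit_coercive pN uN.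
have : l <= l - C^-1.
  apply: ge_sup => // _ [x /= x0 <-]; rewrite ler_pdivrMr ?dp//.
  have := HC x; rewrite fN -(ler_pdivrMl _ _ C0) => H; rewrite mulrBl; lra.
by rewrite leNgt ltrBlDr ltrDl invr_gt0 C0.
Qed.

Lemma eigenvalueN M (a : R) : eigenvalue M a -> eigenvalue (- M) (- a).
Proof.
move=> /eigenvalueP[v vM v0]; apply/eigenvalueP; exists v => //.
by rewrite mulmxN vM scaleNr.
Qed.

(** Needed because [spectral_norm] is a supremum, which is only meaningful for
    a bounded set. *)
Lemma eigenvalue_bound M : exists K : R, forall a, eigenvalue M a -> `|a| <= K.
Proof.
have [K K0 HK] := mxapp_bounded M^T.
exists (1 + K) => a /eigenvalueP[v vM v0].
pose x j := v 0 j.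
have ax : mxapp M^T x = a \*o x.
  apply/funext => j; have /matrixP/(_ 0 j) := vM; rewrite !mxE /x /= => <-.
  by apply: eq_bigr => k _; rewrite mxE mulrC.
have := HK x; rewrite ax dotZr dotC dotZr mulrA -expr2.
have xp : 0 < dot x x.
  rewrite lt_def dot_ge0 andbT; apply: contraNneq v0 => x0; apply/eqP/rowP => j.
  by rewrite mxE -[LHS]/(x j) (dot_eq0 x0 j).
rewrite ler_pM2r// -[a ^+ 2]real_normK ?num_real// => H.
have := normr_ge0 a; nra.
Qed.

Lemma eigenvalue_le_spectral_norm M (a : R) : eigenvalue M a -> `|a| <= spectral_norm M.
Proof.
move=> Ma; have [K HK] := eigenvalue_bound M.
by apply: ub_le_sup; [exists K => _ [b /= /HK ? <-] | exists a].
Qed.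

(** The largest Rayleigh quotients of [M] and of [- M] are eigenvalues up to
    sign. *)
Lemma form_le_spectral_norm M x : M^T = M -> `|form M x x| <= spectral_norm M * dot x x.
Proof.
move=> sM; have [n0|n0] := posnP n.
  by rewrite /form /dot !big1 ?mulr0 ?normr0// => -[j jn] _; exfalso; rewrite n0 in jn.
have [l el Hl] := rayleigh_max sM n0.
have sN : (- M)^T = - M by rewrite linearN /= sM.
have [k ek Hk] := rayleigh_max sN n0.
have := eigenvalue_le_spectral_norm el.
have := eigenvalueN ek; rewrite opprK => /eigenvalue_le_spectral_norm.
rewrite normrN => kn ln; have x0 := dot_ge0 x.
have := Hl x; have := Hk x; rewrite formNM => H1 H2.
have := ler_wpM2r x0 (le_trans (ler_norm _) ln).
have := ler_wpM2r x0 (le_trans (ler_norm _) kn).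
rewrite ler_norml; lra.
Qed.

Lemma spectral_norm_ge0 M : 0 <= spectral_norm M.
Proof.
have [[b Mb]|Me] := pselect (exists b, eigenvalue M b).
  exact: le_trans (normr_ge0 b) (eigenvalue_le_spectral_norm Mb).
rewrite /spectral_norm; set S := (X in sup X).
suff -> : S = set0 by rewrite sup0.
by rewrite -subset0 => _ [b /= Mb _]; apply: Me; exists b.
Qed.

(** Polarization: the bound for the quadratic form at [x + t y] and [x - t y]
    gives, for all [t], a nonnegative quadratic polynomial in [t] whose
    discriminant is the claim. *)
Lemma form_spectral_norm M x y : M^T = M ->
  form M x y ^+ 2 <= spectral_norm M ^+ 2 * dot x x * dot y y.
Proof.
move=> sM; set m := spectral_norm M; have m0 : 0 <= m := spectral_norm_ge0 M.
have -> : m ^+ 2 * dot x x * dot y y = (m * dot x x) * (m * dot y y) by ring.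
apply: discriminant => [|t]; first by rewrite mulr_ge0 ?dot_ge0.
have := form_le_spectral_norm (x \+ (t \*o y)) sM; rewrite -/m.
have := form_le_spectral_norm (x \+ ((- t) \*o y)) sM; rewrite -/m.
rewrite !form_expand//.
have dE (s : R) : dot (x \+ (s \*o y)) (x \+ (s \*o y)) =
    dot x x + 2 * s * dot x y + s ^+ 2 * dot y y.
  by have := form_expand x y s (trmx1 R n); rewrite !form_scalar !mul1r.
rewrite !dE !ler_norml => /andP[H1 H2] /andP[H3 H4]; lra.
Qed.

Lemma mxapp_spectral_norm M x : M^T = M ->
  dot (mxapp M x) (mxapp M x) <= spectral_norm M ^+ 2 * dot x x.
Proof.
move=> sM; have := form_spectral_norm (mxapp M x) x sM; rewrite -/(dot _ _).
set d := dot (mxapp M x) _ => H.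
have [d0|d0] := eqVneq d 0; first by rewrite d0 mulr_ge0 ?sqr_ge0 ?dot_ge0.
have dp : 0 < d by rewrite lt_def d0 dot_ge0.
by rewrite -(ler_pM2r dp) -expr2 (le_trans H)// mulrAC.
Qed.

End LinearAlgebra.

(** * Elementary trigonometry and inequalities *)

Section Trigonometry.
Local Open Scope classical_set_scope.
Local Open Scope ring_scope.
Variable R : realType.
Implicit Types x y : R.

Lemma sin_shift x (m : int) : sin (x + m%:~R * (2 * pi)) = sin x.
Proof.
have H (k : nat) y : sin (y + k%:R * (2 * pi)) = sin y.
  by rewrite !mulr_natl (periodicn (@sinD2pi R)).
case: m => k; first by rewrite -pmulrn H.
by rewrite NegzE mulrNz mulNr -[LHS](H k.+1) subrK.
Qed.

Lemma cos_shift x (m : int) : cos (x + m%:~R * (2 * pi)) = cos x.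
Proof.
have H (k : nat) y : cos (y + k%:R * (2 * pi)) = cos y.
  by rewrite !mulr_natl (periodicn (@cosD2pi R)).
case: m => k; first by rewrite -pmulrn H.
by rewrite NegzE mulrNz mulNr -[LHS](H k.+1) subrK.
Qed.

Lemma sin0_cos_gt0 x : sin x = 0 -> 0 < cos x ->
  exists m : int, x = m%:~R * (2 * pi).
Proof.
move=> s0 c0; have p0 := pi_gt0 R.
pose m := Num.floor (x / (2 * pi) + 1 / 2); exists m.
pose y := x - m%:~R * (2 * pi).
have yE : y = x + (- m)%:~R * (2 * pi) by rewrite /y mulrNz mulNr.
have cy : cos y = 1.
  have c1 : `|cos x| = 1 by apply: sin0cos1.
  by rewrite yE cos_shift -c1 gtr0_norm.
have p2 : 0 < 2 * pi :> R by lra.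
have xE : x = x / (2 * pi) * (2 * pi) by rewrite divfK// gt_eqF.
have m1 : m%:~R * (2 * pi) <= (x / (2 * pi) + 1 / 2) * (2 * pi).
  by rewrite ler_pM2r// floor_le.
have m2 : (x / (2 * pi) + 1 / 2) * (2 * pi) < (m%:~R + 1) * (2 * pi).
  by rewrite ltr_pM2r// (_ : m%:~R + 1 = (m + 1)%:~R) ?floorD1_gt// intrD.
have yp : `|y| <= pi.
  by move: (x / (2 * pi)) xE m1 m2 => q xE m1 m2; rewrite ler_norml /y; lra.
have : `|y| = 0.
  apply: (@cos_inj R); first by rewrite in_itv /= normr_ge0 yp.
    by rewrite in_itv /= lexx pi_ge0.
  by rewrite cos_norm cy cos0.
by move/normr0_eq0/eqP; rewrite subr_eq0 => /eqP.
Qed.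

(** Polar coordinates of [(u, v)], without the radius: [phi] is an argument. *)
Lemma polar (u v : R) : exists2 phi : R, u * sin phi = v * cos phi &
  0 <= u * cos phi + v * sin phi.
Proof.
pose d := Num.sqrt (u ^+ 2 + v ^+ 2).
have d2 : d ^+ 2 = u ^+ 2 + v ^+ 2 by rewrite sqr_sqrtr// addr_ge0 ?sqr_ge0.
have d0 : 0 <= d by rewrite sqrtr_ge0.
have [dz|dn] := eqVneq d 0.
  have u0 : u = 0 by apply/eqP; rewrite -sqrf_eq0 eq_le sqr_ge0 andbT; move: d2; rewrite dz; have := sqr_ge0 v; nra.
  have v0 : v = 0 by apply/eqP; rewrite -sqrf_eq0 eq_le sqr_ge0 andbT; move: d2; rewrite dz; have := sqr_ge0 u; nra.
  by exists 0; rewrite u0 v0 !mul0r ?addr0.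
have dp : 0 < d by rewrite lt_def dn.
pose w := u / d; pose z := v / d.
have uE : u = w * d by rewrite divfK.
have vE : v = z * d by rewrite divfK.
have wz : w ^+ 2 + z ^+ 2 = 1.
  by rewrite !expr_div_n -mulrDl -d2 divff// expf_neq0.
have w1 : -1 <= w <= 1.
  by rewrite -ler_norml -(ler_sqr (x := `|w|)) ?nnegrE// real_normK ?num_real// expr1n -wz lerDl sqr_ge0.
have cE : cos (acos w) = w by rewrite acosK// in_itv.
have sE : sin (acos w) = `|z|.
  by rewrite sin_acos// -sqrtr_sqr; congr Num.sqrt; rewrite -wz; ring.
have P : 0 <= w * d * w + z * d * z.
  have -> : w * d * w + z * d * z = d * (w ^+ 2 + z ^+ 2) by ring.
  by rewrite wz mulr1.
have [z0|z0] := leP 0 z.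
  by exists (acos w); rewrite uE vE cE sE ger0_norm//; ring.
by exists (- acos w); rewrite uE vE cosN sinN cE sE ltr0_norm// opprK//; ring.
Qed.

Lemma norm_sin_le x : `|sin x| <= `|x|.
Proof.
wlog x0 : x / 0 <= x => [H|].
  have [|x0] := leP 0 x; first exact: H.
  by rewrite -normrN -sinN -[in leRHS]normrN H// oppr_ge0 ltW.
have D z : z \in `]0, x[%R -> is_derive z 1 (@sin R) (cos z) by move=> _; exact: is_derive_sin.
have C : {within `[0, x], continuous (@sin R)}.
  by apply: continuous_subspaceT; exact: continuous_sin.
have [z _] := MVT_segment x0 D C; rewrite sin0 !subr0 => ->.
by rewrite normrM ler_piMl// cos_max.
Qed.

(** Half-angle formula: [1 - cos x] is twice the square of [sin (x / 2)]. *)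
Lemma one_sub_cos_le x : `|1 - cos x| <= 2 * `|x|.
Proof.
rewrite -[x in cos x](@divfK _ 2)// mulr_natr cos_mulr2n cos2sin2.
set t := sin _; have -> : 1 - ((1 - t ^+ 2) *+ 2 - 1) = 2 * t ^+ 2 by rewrite -mulr_natl; ring.
rewrite ger0_norm; last by rewrite mulr_ge0 ?ler0n ?sqr_ge0.
rewrite ler_pM2l//.
have t1 : `|t| <= 1 by exact: sin_max.
have tx : `|t| <= `|x| / 2.
  by apply: le_trans (norm_sin_le _) _; rewrite normrM normfV [X in _ / X]ger0_norm.
rewrite -[t ^+ 2]real_normK ?num_real//; have := normr_ge0 t; have := normr_ge0 x; nra.
Qed.

Lemma one_sub_cos_le2 x : `|1 - cos x| <= x ^+ 2.
Proof.
rewrite -[x in cos x](@divfK _ 2)// mulr_natr cos_mulr2n cos2sin2.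
set t := sin _; have -> : 1 - ((1 - t ^+ 2) *+ 2 - 1) = 2 * t ^+ 2 by rewrite -mulr_natl; ring.
rewrite ger0_norm; last by rewrite mulr_ge0 ?ler0n ?sqr_ge0.
have tx : `|t| <= `|x| / 2.
  by apply: le_trans (norm_sin_le _) _; rewrite normrM normfV [X in _ / X]ger0_norm.
rewrite -[t ^+ 2]real_normK ?num_real// -[x ^+ 2]real_normK ?num_real//.
have := normr_ge0 t; have := normr_ge0 x; nra.
Qed.

Lemma sub_sin_le x : `|x - sin x| <= 2 * x ^+ 2.
Proof.
wlog x0 : x / 0 <= x => [H|].
  have [|x0] := leP 0 x; first exact: H.
  rewrite -normrN -[x ^+ 2]sqrrN (_ : - (x - sin x) = - x - sin (- x)).
    by rewrite H// oppr_ge0 ltW.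
  by rewrite sinN; ring.
have D z : z \in `]0, x[%R -> is_derive z 1 (fun z => z - sin z) (1 - cos z).
  by move=> _; apply: is_deriveB.
have C : {within `[0, x], continuous (fun z => z - sin z)}.
  apply: continuous_subspaceT => z; apply: cvgB; first exact: cvg_id.
  exact: continuous_sin.
have [z] := MVT_segment x0 D C; rewrite in_itv /= sin0 !subr0 => /andP[z0 zx] ->.
rewrite normrM [X in _ * X]ger0_norm// expr2 mulrA ler_wpM2r//.
by rewrite (le_trans (one_sub_cos_le _))// ler_pM2l// ger0_norm.
Qed.

(** By the addition formula the remainder is made of [1 - cos w] and [w - sin w],
    which are both of second order. *)
Lemma sin_taylor x w : `|sin (x + w) - sin x - cos x * w| <= 3 * w ^+ 2.
Proof.
have -> : sin (x + w) - sin x - cos x * w =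
    - (sin x * (1 - cos w)) - cos x * (w - sin w) by rewrite sinD; ring.
apply: le_trans (ler_normB _ _) _; rewrite normrN !normrM.
have := ler_pM (normr_ge0 _) (normr_ge0 _) (sin_max x) (one_sub_cos_le2 w).
have := ler_pM (normr_ge0 _) (normr_ge0 _) (cos_max x) (sub_sin_le w).
lra.
Qed.

Lemma sin_lipschitz x y : `|sin x - sin y| <= `|x - y|.
Proof.
wlog xy : x y / y <= x => [H|].
  have [|/ltW] := leP y x; first exact: H.
  by move=> xy; rewrite distrC [X in _ <= X]distrC; exact: H.
have D z : z \in `]y, x[%R -> is_derive z 1 (@sin R) (cos z) by move=> _; exact: is_derive_sin.
have C : {within `[y, x], continuous (@sin R)}.
  by apply: continuous_subspaceT; exact: continuous_sin.
have [z _ ->] := MVT_segment xy D C.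
by rewrite normrM ler_piMl// cos_max.
Qed.

Lemma quadrant (b : R) : 0 <= b <= pi / 2 -> 0 <= cos b /\ 0 <= sin b.
Proof.
move=> /andP[b0 b2]; have := pi_ge0 R => p0; split.
  by apply: cos_ge0_pihalf; lra.
by apply: sin_ge0_pi; lra.
Qed.

(** [(C, B)] is the point of angle [b] in the first quadrant and [(x, t)] a point
    of the upper half circle beyond it; [C * t - B * x] is the sine of the angle
    between the two. *)
Lemma arc_excess_bounds (C B x t : R) : 0 <= C -> 0 <= B -> C ^+ 2 + B ^+ 2 = 1 ->
  0 <= t -> x ^+ 2 + t ^+ 2 = 1 -> x <= C -> 0 <= C * t - B * x <= 1.
Proof.
move=> C0 B0 CB t0 xt xC; apply/andP; split.
  rewrite subr_ge0; have [x0|x0] := leP x 0.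
    by apply: (@le_trans _ _ 0); [rewrite mulr_ge0_le0 | rewrite mulr_ge0].
  have Bt : B <= t by rewrite -ler_sqr ?nnegrE//; nra.
  by rewrite [C * t]mulrC ler_pM// ltW.
rewrite (le_trans (ler_norm _))// -(ler_sqr (x := `|_|)) ?nnegrE// real_normK ?num_real//.
have -> : (1 : R) ^+ 2 = (C * t - B * x) ^+ 2 + (C * x + B * t) ^+ 2.
  by transitivity ((C ^+ 2 + B ^+ 2) * (x ^+ 2 + t ^+ 2)); [rewrite CB xt mulr1 expr1n | ring].
by rewrite lerDl sqr_ge0.
Qed.

(** A point [w * (x, t)] on the ray through [(x, t)] is at distance at least [u]
    from [(u, 0)] if [x <= 0], and at least [u * t] otherwise.  Both dominate [u]
    times the sine of the angle [b] and [u] times the sine of the angle from [b]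
    to the ray. *)
Lemma arc_deviation_bounds (C B x t w u : R) : 0 <= C -> 0 <= B -> C ^+ 2 + B ^+ 2 = 1 ->
  0 <= t -> x ^+ 2 + t ^+ 2 = 1 -> x <= C -> 0 <= w -> 0 <= u ->
  u ^+ 2 * B ^+ 2 <= (w * x - u) ^+ 2 + (w * t) ^+ 2 /\
  u ^+ 2 * (C * t - B * x) ^+ 2 <= (w * x - u) ^+ 2 + (w * t) ^+ 2.
Proof.
move=> C0 B0 CB t0 xt xC w0 u0; have /andP[v0 v1] := arc_excess_bounds C0 B0 CB t0 xt xC.
have [x0|x0] := leP x 0.
  have E : u ^+ 2 <= (w * x - u) ^+ 2 + (w * t) ^+ 2.
    have wux : 0 <= w * u * - x by rewrite !mulr_ge0// oppr_ge0.
    have -> : (w * x - u) ^+ 2 + (w * t) ^+ 2 = w ^+ 2 * (x ^+ 2 + t ^+ 2) + 2 * (w * u * - x) + u ^+ 2 by ring.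
    by rewrite xt mulr1 lerDr addr_ge0 ?sqr_ge0// mulr_ge0.
  by split; apply: le_trans E; rewrite ler_piMr ?sqr_ge0// expr_le1//; nra.
have E : u ^+ 2 * t ^+ 2 <= (w * x - u) ^+ 2 + (w * t) ^+ 2.
  have -> : (w * x - u) ^+ 2 + (w * t) ^+ 2 = w ^+ 2 * (x ^+ 2 + t ^+ 2) - 2 * (w * u * x) + u ^+ 2 by ring.
  rewrite xt mulr1; have -> : t ^+ 2 = 1 - x ^+ 2 by rewrite -xt; ring.
  rewrite -subr_ge0; set e := (X in 0 <= X); have -> : e = (w - u * x) ^+ 2 by rewrite /e; ring.
  exact: sqr_ge0.
have Bt : B <= t by rewrite -ler_sqr ?nnegrE//; nra.
have vt : C * t - B * x <= t.
  have C1 : C <= 1 by nra.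
  have Bx : 0 <= B * x by rewrite mulr_ge0 // ltW.
  nra.
by split; apply: le_trans E; rewrite ler_wpM2l ?sqr_ge0// ler_sqr ?nnegrE.
Qed.

Lemma arc_sin_bound (C B x t : R) : 0 <= C -> 0 <= B -> C ^+ 2 + B ^+ 2 = 1 ->
  0 <= t -> x ^+ 2 + t ^+ 2 = 1 -> C < x -> t <= B.
Proof. by move=> C0 B0 CB t0 xt xC; rewrite -ler_sqr ?nnegrE//; nra. Qed.

Lemma mul_le_of_sqr (w x y d : R) : 0 <= w -> w * x ^+ 2 <= d -> w * y ^+ 2 <= d ->
  w * x * y <= d.
Proof. move=> w0 q1 q2; have := mulr_ge0 w0 (sqr_ge0 (x - y)); lra. Qed.

Lemma square_balance (x y z w f : R) : 0 <= 7 * y * x -> 7 * y * x <= - 8 * f ->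
  f ^+ 2 <= w ^+ 2 * x * z -> 49 * y ^+ 2 * x * x <= 64 * w ^+ 2 * z * x.
Proof.
move=> yx0 yxf; have : (7 * y * x) ^+ 2 <= (- 8 * f) ^+ 2.
  by rewrite ler_sqr ?nnegrE // (le_trans yx0 yxf).
lra.
Qed.

(** [y ^+ 2 >= 4 * w ^+ 2 * (g + 1) ^+ 2 >= 16 * w ^+ 2 * g], as
    [(g + 1) ^+ 2 >= 4 * g]. *)
Lemma step_gain (y w g x' x : R) : 0 < w -> 0 < g -> 0 <= x' ->
  2 * w * (g + 1) <= y -> 49 * y ^+ 2 * x' <= 64 * w ^+ 2 * x -> g * x' <= x.
Proof.
move=> w0 g0 x'0 gy H; have w2 : 0 < w ^+ 2 by rewrite exprn_gt0.
have wg0 : 0 <= 2 * w * (g + 1) by rewrite !mulr_ge0 ?addr_ge0 ?(ltW w0) ?(ltW g0).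
have G : 16 * w ^+ 2 * g <= y ^+ 2.
  have : (2 * w * (g + 1)) ^+ 2 <= y ^+ 2 by rewrite ler_sqr ?nnegrE ?(le_trans wg0 gy).
  have := mulr_ge0 (ltW w2) (sqr_ge0 (g - 1)); lra.
rewrite -(ler_pM2l w2).
have := mulr_ge0 (ltW w2) (mulr_ge0 (ltW g0) x'0); have := ler_wpM2r x'0 G; lra.
Qed.

Lemma double_lt (x y z : R) : x + 1 < y -> 2 * y < z + 2 -> 2 * x < z.
Proof. lra. Qed.

Lemma count_absurd (N k y : R) : 1 <= N -> 1 <= k -> (N / 6) ^+ 2 < y ->
  48 * (k * y) <= N -> False.
Proof.
move=> N1 k1 Ny H; have y0 : 0 <= y := le_trans (sqr_ge0 _) (ltW Ny).
have := ler_wpM2r y0 k1; rewrite mul1r => yk.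
have : 48 * (N / 6) ^+ 2 < N by lra.
rewrite expr_div_n; nra.
Qed.

End Trigonometry.

(** * Equilibria with nonnegative curvature on a near-regular graph *)

Section Combinatorics.
Variables (R : realType) (n : nat) (A : 'M[R]_n) (p : R) (theta : 'I_n -> R).

(** Twice the Hessian form of the energy at [theta], by form_lapmx_diff. *)
Definition curvature_nonneg := forall x : 'I_n -> R,
  0 <= \sum_j \sum_k A j k * cos (theta k - theta j) * (x j - x k) ^+ 2.

Local Notation N := (n%:R).
Local Notation DA := (DeltaA p A).
Local Notation DL := (DeltaL p (lapmx A)).
Local Notation a := (spectral_norm DA).
Local Notation l := (spectral_norm DL).
Local Notation c := (fun j => cos (theta j)).
Local Notation s := (fun j => sin (theta j)).
Local Notation r := (\sum_j cos (theta j)).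

Hypothesis sA : A^T = A.
Hypothesis A_ge0 : forall j k, 0 <= A j k.
Hypothesis p_gt0 : 0 < p.
Hypothesis n_gt0 : (0 < n)%N.

Lemma DeltaA_sym : DA^T = DA.
Proof. by apply/matrixP => j k; rewrite !mxE (sym_entry j k sA). Qed.

Lemma DeltaL_sym : DL^T = DL.
Proof.
by rewrite /DeltaL linearB linearD linearZ /= lapmx_sym// trmx_const tr_scalar_mx.
Qed.

Lemma mxapp_DeltaA x j : mxapp A x j = p * \sum_k x k + mxapp DA x j.
Proof.
rewrite mulr_sumr -big_split; apply: eq_bigr => k _ /=; rewrite !mxE; ring.
Qed.

Lemma form_DeltaA x y : form A x y = p * (\sum_j x j) * (\sum_j y j) + form DA x y.
Proof.
rewrite /form /dot (eq_bigr (fun j => x j * (p * \sum_k y k) + x j * mxapp DA y j)).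
  by rewrite big_split -mulr_suml /=; ring.
by move=> j _; rewrite mxapp_DeltaA mulrDr.
Qed.

Lemma mxapp_DeltaL x j :
  mxapp (lapmx A) x j = N * p * x j - p * \sum_k x k + mxapp DL x j.
Proof.
have -> : mxapp (lapmx A) x j = mxapp DL x j - p * (\sum_k x k) + mxapp (N * p)%:M x j.
  rewrite mulr_sumr /mxapp -sumrB -big_split; apply: eq_bigr => k _ /=.
  rewrite /DeltaL; move: (lapmx A) => L; rewrite !mxE.
  by case: (j == k); rewrite ?mulr1n ?mulr0n; ring.
rewrite mxapp_scalar /=; ring.
Qed.

(** Both [L] and [p J - n p] annihilate the constants.  This lets the error term
    for the complement of a set be expressed by the set itself, which is small. *)
Lemma mxapp_DeltaL1 j : mxapp DL (fun=> 1) j = 0.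
Proof.
have := mxapp_DeltaL (fun=> 1) j; rewrite mxapp_lapmx big1; last by move=> k _; rewrite subrr mulr0.
rewrite sumr_const card_ord -[1 *+ n]/N; lra.
Qed.

Lemma form_lapmx x y : form (lapmx A) x y =
  N * p * dot x y - p * (\sum_j x j) * (\sum_j y j) + form DL x y.
Proof.
rewrite /form /dot mulr_sumr mulrAC mulr_sumr -sumrB -big_split; apply: eq_bigr => j _.
by rewrite mxapp_DeltaL /=; ring.
Qed.

Definition ind (P : pred 'I_n) : 'I_n -> R := fun j => (P j)%:R.

Lemma dot_ind P : dot (ind P) (ind P) = \sum_j ind P j.
Proof. by apply: eq_bigr => j _; rewrite /ind; case: (P j); rewrite ?mulr1 ?mulr0. Qed.

(** The number of edges between [S] and the complement of [C]; since these are
    disjoint, it can be computed with the Laplacian, whose error term then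
    involves the small set [C] and not its complement. *)
Lemma form_disjoint (S C : pred 'I_n) : (forall j, S j -> C j) ->
  form A (ind S) (ind (predC C)) =
  p * (\sum_j ind S j) * (N - \sum_j ind C j) + form DL (ind S) (ind C).
Proof.
move=> SC.
have E1 : form A (ind S) (ind (predC C)) = - form (lapmx A) (ind S) (ind (predC C)).
  rewrite -sumrN; apply: eq_bigr => j _; rewrite mxapp_lapmx -mulrN -sumrN.
  rewrite /ind /=; case: (boolP (S j)) => Sj; last by rewrite !mul0r.
  by congr (_ * _); apply: eq_bigr => k _; rewrite (SC j Sj) /= sub0r mulrN opprK.
have E2 : ind (predC C) = (fun=> 1) \+ ((-1) \*o ind C).
  by apply/funext => j; rewrite /ind /=; case: (C j); rewrite /= ?mulr0n ?mulr1n; ring.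
have E3 : form DL (ind S) (ind (predC C)) = - form DL (ind S) (ind C).
  rewrite E2 formDr formZr mulN1r [form _ _ _]big1 ?add0r// => j _.
  by rewrite mxapp_DeltaL1 mulr0.
rewrite E1 form_lapmx E3.
have -> : dot (ind S) (ind (predC C)) = 0.
  rewrite /dot big1// => j _; rewrite /ind /=; case: (boolP (S j)) => Sj; last by rewrite mul0r.
  by rewrite (SC j Sj) mulr0.
have -> : \sum_j ind (predC C) j = N - \sum_j ind C j.
  rewrite E2 big_split /= sumr_const card_ord -[1 *+ n]/N -mulr_sumr; ring.
ring.
Qed.

Hypothesis sin_centred : \sum_j sin (theta j) = 0.
Hypothesis r_ge0 : 0 <= r.
Hypothesis equi : equilibrium A theta.
Hypothesis curv : curvature_nonneg.
Hypothesis a_gt0 : 0 < a.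
Hypothesis a_lt : 12 * a < N * p.
Hypothesis l_lt : 4 * l < N * p.

Lemma dot_cos_sin : dot c c + dot s s = N.
Proof.
rewrite /dot -big_split /= (eq_bigr (fun=> 1)) ?sumr_const ?card_ord//.
by move=> j _; rewrite -!expr2 cos2Dsin2.
Qed.

(** The curvature condition for the vectors [cos (theta j)] and [sin (theta j)]
    adds up to the inequality between the sums of [A j k * D j k] and
    [A j k * D j k ^+ 2], where [D j k = cos (theta k - theta j)].  Replacing [A]
    by [p J] turns the first sum into [p * r ^+ 2]; it turns the second into at
    least [p * n ^+ 2 / 2], since [D j k ^+ 2 = (1 + cos (2 (theta k - theta j))) / 2].
    The two errors are at most [n * |DeltaA|] each. *)
Lemma order_parameter_large : N ^+ 2 <= 3 * r ^+ 2.
Proof.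
pose D j k := c j * c k + s j * s k.
pose cc j := c j * c j; pose ss j := s j * s j; pose cs j := c j * s j.
have H : \sum_j \sum_k A j k * D j k ^+ 2 <= \sum_j \sum_k A j k * D j k.
  have := addr_ge0 (curv c) (curv s).
  rewrite -big_split /= (eq_bigr (fun j => \sum_k 2 * (A j k * D j k - A j k * D j k ^+ 2))).
    have -> : \sum_j \sum_k 2 * (A j k * D j k - A j k * D j k ^+ 2) =
        2 * (\sum_j \sum_k A j k * D j k - \sum_j \sum_k A j k * D j k ^+ 2).
      rewrite mulrBr !mulr_sumr -sumrB; apply: eq_bigr => j _.
      by rewrite !mulr_sumr -sumrB; apply: eq_bigr => k _; rewrite mulrBr.
    by rewrite pmulr_rge0// subr_ge0.
  move=> j _; rewrite -big_split; apply: eq_bigr => k _ /=.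
  have -> : cos (theta k - theta j) = D j k by rewrite cosB /D; ring.
  have := cos2Dsin2 (theta j); have := cos2Dsin2 (theta k).
  rewrite /D; set cj := cos (theta j); set sj := sin (theta j).
  set ck := cos (theta k); set sk := sin (theta k) => Ek Ej.
  rewrite -mulrDr.
  have -> : (cj - ck) ^+ 2 + (sj - sk) ^+ 2 = 2 - 2 * (cj * ck + sj * sk).
    lra.
  ring.
have E1 : \sum_j \sum_k A j k * D j k = form A c c + form A s s.
  rewrite !formE -big_split; apply: eq_bigr => j _; rewrite -big_split; apply: eq_bigr => k _.
  by rewrite /D /=; ring.
have E2 : \sum_j \sum_k A j k * D j k ^+ 2 = form A cc cc + 2 * form A cs cs + form A ss ss.
  rewrite !formE mulr_sumr -!big_split; apply: eq_bigr => j _; rewrite mulr_sumr -!big_split.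
  by apply: eq_bigr => k _; rewrite /D /cc /cs /ss /=; ring.
move: H; rewrite E1 E2 !form_DeltaA sin_centred !mulr0 add0r => H.
have B x := form_le_spectral_norm x DeltaA_sym.
have := B c; have := B s; have := B cc; have := B cs; have := B ss.
rewrite !ler_norml => /andP[b1 _] /andP[b2 _] /andP[b3 _] /andP[_ b4] /andP[_ b5].
have q4 : dot cc cc + 2 * dot cs cs + dot ss ss = N.
  rewrite /dot mulr_sumr -!big_split /= (eq_bigr (fun=> 1)) ?sumr_const ?card_ord//.
  move=> j _; have := cos2Dsin2 (theta j); rewrite /cc /cs /ss => E.
  by transitivity ((cos (theta j) ^+ 2 + sin (theta j) ^+ 2) ^+ 2); [ring | rewrite E expr1n].
have q2 : \sum_j cc j + \sum_j ss j = N by exact: dot_cos_sin.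
have sc : a * dot c c + a * dot s s = a * N by rewrite -mulrDr dot_cos_sin.
have sq : a * dot cc cc + 2 * (a * dot cs cs) + a * dot ss ss = a * N by rewrite -q4; ring.
have sqr0 := sqr_ge0 (\sum_j cc j - \sum_j ss j).
have pcs : 0 <= p * (\sum_j cs j) * (\sum_j cs j).
  by rewrite -mulrA mulr_ge0 ?(ltW p_gt0)// -expr2 sqr_ge0.
have K : p * N ^+ 2 <= 2 * (p * (\sum_j cc j) * (\sum_j cc j) + p * (\sum_j ss j) * (\sum_j ss j)).
  rewrite -subr_ge0; set X := \sum_j cc j; set Y := \sum_j ss j.
  have -> : N = X + Y by rewrite -q2.
  have -> : 2 * (p * X * X + p * Y * Y) - p * (X + Y) ^+ 2 = p * (X - Y) ^+ 2 by ring.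
  by rewrite mulr_ge0 ?sqr_ge0 ?(ltW p_gt0).
have {}H : p * N ^+ 2 <= 2 * (p * r * r) + 4 * (a * N) by lra.
have N0 : 0 < N :> R by rewrite ltr0n.
have aN : 12 * (a * N) <= p * N ^+ 2 by move: (ler_wpM2r (ltW N0) (ltW a_lt)); lra.
rewrite -(ler_pM2l p_gt0); lra.
Qed.

Definition pull j : R := \sum_k A j k * cos (theta k - theta j).

(** The curvature condition for the indicator of [j]; a loop at [j] only adds to
    the sum. *)
Lemma pull_ge0 j : 0 <= pull j.
Proof.
have := curv (ind (pred1 j)).
rewrite (bigD1 j)//= (eq_bigr (fun k => A j k * cos (theta k - theta j) * (k != j)%:R)); last first.
  move=> k _; rewrite /ind /= eqxx eq_sym; case: eqVneq => _ /=; first by rewrite subrr expr0n mulr0.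
  by rewrite subr0 expr1n.
rewrite [X in _ + X](_ : _ = \sum_k A j k * cos (theta k - theta j) * (k != j)%:R).
  rewrite -mulr2n pmulrn_lge0// => H; rewrite /pull (bigD1 j)//= addrC.
  move: H; rewrite (bigD1 j)//= eqxx mulr0 add0r => H.
  rewrite addr_ge0//; last by rewrite subrr cos0 mulr1.
  by apply: le_trans H _; apply: ler_sum => k kj; rewrite kj mulr1.
rewrite [RHS](bigD1 j)//= eqxx mulr0 add0r; apply: eq_bigr => i ij.
rewrite (bigD1 j)//= big1 ?addr0.
  rewrite /ind /= eqxx (negbTE ij) sub0r sqrrN expr1n (sym_entry _ _ sA) -cosN.
  by congr (_ * cos _ * _); ring.
by move=> k kj; rewrite /ind /= (negbTE kj) (negbTE ij) subrr expr0n mulr0.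
Qed.

(** Together with mxapp_sin: [(A z) j = pull j * z j], because the part of
    [(A z) j] orthogonal to [z j] is the right-hand side of the system. *)
Lemma mxapp_cos j : mxapp A c j = pull j * c j.
Proof.
have -> : pull j * c j = pull j * c j - kuramoto A theta j * s j by rewrite equi mul0r subr0.
rewrite /pull /kuramoto !mulr_suml -sumrB; apply: eq_bigr => k _.
rewrite /= cosB sinB -[LHS]mulr1 -(cos2Dsin2 (theta j)); ring.
Qed.

Lemma mxapp_sin j : mxapp A s j = pull j * s j.
Proof.
have -> : pull j * s j = pull j * s j + kuramoto A theta j * c j by rewrite equi mul0r addr0.
rewrite /pull /kuramoto !mulr_suml -big_split; apply: eq_bigr => k _.
rewrite /= cosB sinB -[LHS]mulr1 -(cos2Dsin2 (theta j)); ring.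
Qed.

(** The square of the modulus of [(DeltaA z) j]. *)
Definition deviation j : R := (mxapp DA c j) ^+ 2 + (mxapp DA s j) ^+ 2.

Lemma deviationE j : deviation j =
  (pull j * c j - p * r) ^+ 2 + (pull j * s j) ^+ 2.
Proof.
by rewrite /deviation -mxapp_cos -mxapp_sin !mxapp_DeltaA sin_centred mulr0 add0r addrAC subrr add0r.
Qed.

Lemma sum_deviation : \sum_j deviation j <= a ^+ 2 * N.
Proof.
rewrite big_split -dot_cos_sin mulrDr.
by apply: lerD; rewrite -/(dot _ _) mxapp_spectral_norm ?DeltaA_sym.
Qed.

(** Phrased with cosines, so that phases need no representatives modulo [2 * pi]. *)
Definition far (b : R) : pred 'I_n := fun j => cos (theta j) <= cos b.

(** For a phase in [[- pi, pi]] of absolute value [x] this is [sin (x - b)]. *)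
Definition excess (b : R) j : R := cos b * `|s j| - sin b * c j.

Lemma far_deviation b j : 0 <= b <= pi / 2 -> far b j ->
  [/\ 0 <= excess b j <= 1,
      (p * r) ^+ 2 * sin b ^+ 2 <= deviation j &
      (p * r) ^+ 2 * excess b j ^+ 2 <= deviation j].
Proof.
move=> b02 fj; have [C0 B0] := quadrant b02.
have xt : c j ^+ 2 + `|s j| ^+ 2 = 1 by rewrite real_normK ?num_real// cos2Dsin2.
have u0 : 0 <= p * r by rewrite mulr_ge0 ?(ltW p_gt0).
have [H1 H2] := arc_deviation_bounds C0 B0 (cos2Dsin2 b) (normr_ge0 (s j)) xt fj (pull_ge0 j) u0.
split; first exact: arc_excess_bounds (cos2Dsin2 b) (normr_ge0 _) xt fj.
  by rewrite deviationE; apply: le_trans H1 _; rewrite !exprMn real_normK ?num_real.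
by rewrite deviationE; apply: le_trans H2 _; rewrite !exprMn real_normK ?num_real.
Qed.

Definition card_far b : R := \sum_j ind (far b) j.

Lemma card_far_ge0 b : 0 <= card_far b.
Proof. by apply: sumr_ge0 => j _; rewrite /ind ler0n. Qed.

Lemma mean_field_large : p ^+ 2 * N ^+ 2 <= 3 * (p * r) ^+ 2.
Proof. by rewrite exprMn [3 * _]mulrCA ler_wpM2l ?sqr_ge0// order_parameter_large. Qed.

Lemma deviation_ge0 j : 0 <= deviation j. Proof. by rewrite addr_ge0 ?sqr_ge0. Qed.

(** The constants 12 and 48 match: each far vertex contributes at least
    [(p * r * sin b) ^+ 2 >= (n * p) ^+ 2 / 3 * (12 * |DeltaA| / (n * p)) ^+ 2 = 48 * |DeltaA| ^+ 2]
    to a sum that is at most [|DeltaA| ^+ 2 * n]. *)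
Lemma card_far_chebyshev b : 0 <= b <= pi / 2 -> 12 * a <= N * p * sin b ->
  48 * card_far b <= N.
Proof.
move=> b02 ab; have [_ B0] := quadrant b02.
have H : card_far b * ((p * r) ^+ 2 * sin b ^+ 2) <= a ^+ 2 * N.
  apply: le_trans sum_deviation; rewrite mulr_suml; apply: ler_sum => j _.
  rewrite /ind; case: (boolP (far b j)) => fj; rewrite ?mul0r ?deviation_ge0// mul1r.
  by have [_ ->] := far_deviation b02 fj.
have K : 48 * a ^+ 2 <= (p * r) ^+ 2 * sin b ^+ 2.
  have : (12 * a) ^+ 2 <= (N * p * sin b) ^+ 2.
    by rewrite ler_sqr ?nnegrE//; [rewrite mulr_ge0 // ltW | rewrite !mulr_ge0 // ltW].
  have := ler_wpM2r (sqr_ge0 (sin b)) mean_field_large; rewrite !exprMn; lra.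
have a2 : 0 < a ^+ 2 by rewrite exprn_gt0.
rewrite -(ler_pM2l a2); have := ler_wpM2l (card_far_ge0 b) K; lra.
Qed.

Lemma far_mono b b' j : 0 <= b -> b <= b' -> b' <= pi -> far b' j -> far b j.
Proof.
move=> b0 bb' b'p; rewrite /far => H; apply: le_trans H _.
rewrite leNgt ltr_cos ?in_itv /= -?leNgt ?bb'//.
  by rewrite b'p (le_trans b0).
by rewrite b0 (le_trans bb').
Qed.

(** At a vertex [j] with phase beyond [b + alpha], say in the upper half circle,
    the vector [(A z) j] is a nonnegative multiple of [z j], so its component
    normal to the ray of angle [b + alpha] points outwards.  A neighbour with
    phase in [[- b, b]] pulls it inwards by at least [sin alpha], a neighbour
    between the angles [b] and [b + alpha] does not pull outwards, and one beyond
    [b + alpha] pulls outwards by at most its excess. *)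
Lemma far_local (b alpha : R) j : 0 <= b -> 0 <= alpha -> b + alpha <= pi / 2 ->
  far (b + alpha) j ->
  sin alpha * mxapp A (ind (predC (far b))) j <=
  mxapp A (fun k => ind (far (b + alpha)) k * excess (b + alpha) k) j.
Proof.
move=> b0 al0 bal fj; set b' := b + alpha.
have pi0 := pi_ge0 R.
have b'02 : 0 <= b' <= pi / 2 by rewrite bal addr_ge0.
have b02 : 0 <= b <= pi / 2 by rewrite b0 (le_trans _ bal)// lerDl.
have [C0 B0] := quadrant b02; have [C'0 B'0] := quadrant b'02.
have [/andP[v0 _] _ _] := far_deviation b'02 fj.
(* The sign treats the upper and the lower half circle at once. *)
pose sg : R := if 0 <= s j then 1 else -1.
have sgj : sg * s j = `|s j|.
  rewrite /sg; case: (lerP 0 (s j)) => sj; first by rewrite ger0_norm// mul1r.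
  by rewrite ltr0_norm// mulN1r.
have sgk k : sg * s k <= `|s k|.
  by rewrite /sg; case: ifP => _; rewrite ?mul1r ?mulN1r ?ler_norm// -normrN ler_norm.
have H : \sum_k A j k * (sin b' * c k - cos b' * (sg * s k)) <= 0.
  have -> : \sum_k A j k * (sin b' * c k - cos b' * (sg * s k)) =
      sin b' * mxapp A c j - cos b' * sg * mxapp A s j.
    by rewrite !mulr_sumr -sumrB; apply: eq_bigr => k _ /=; ring.
  rewrite mxapp_cos mxapp_sin; have := mulr_ge0 (pull_ge0 j) v0.
  by rewrite /excess -/b' -sgj /=; lra.
rewrite -subr_ge0 mulr_sumr -sumrB; apply: le_trans (_ : 0 <= - (\sum_k A j k * (sin b' * c k - cos b' * (sg * s k)))) _.
  by rewrite oppr_ge0.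
rewrite -sumrN; apply: ler_sum => k _.
rewrite -mulrN [sin alpha * _]mulrCA -mulrBr ler_wpM2l//.
have sk := ler_wpM2l C'0 (sgk k).
have xt : c k ^+ 2 + `|s k| ^+ 2 = 1 by rewrite real_normK ?num_real// cos2Dsin2.
rewrite /ind /=; have [f'k|f'k] := boolP (far b' k).
  have -> : far b k by apply: far_mono f'k => //; rewrite ?lerDl//; lra.
  by rewrite /= mulr0 subr0 mul1r /excess; lra.
have n'k : cos b' < c k by rewrite ltNge.
have tk := arc_sin_bound C'0 B'0 (cos2Dsin2 b') (normr_ge0 _) xt n'k.
have [fk|fk] := boolP (far b k); rewrite /= ?mulr0 ?mul0r ?mulr1.
  rewrite subr0 oppr_le0.
  have := ler_wpM2l C'0 tk; have := ler_wpM2l B'0 (ltW n'k); lra.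
have nk : cos b < c k by rewrite ltNge.
have {}tk := arc_sin_bound C0 B0 (cos2Dsin2 b) (normr_ge0 _) xt nk.
have -> : sin alpha = sin b' * cos b - cos b' * sin b.
  by rewrite -sinB /b' addrAC subrr add0r.
have := ler_wpM2l C'0 tk; have := ler_wpM2l B'0 (ltW nk); lra.
Qed.

(** Summing far_local over the vertices beyond [b + alpha].  The edges inside the
    far set are controlled by [DeltaA]: the mean-field part [p * V] is at most
    [|DeltaA| / 4] per vertex by the deviation bounds, and the error is at most
    [|DeltaA|] per vertex.  Against this stands [sin alpha] times the number of
    edges to near vertices, which is almost [n * p * sin alpha = 12 * |DeltaA|]
    per vertex unless the [DeltaL] error is of the order of the main term. *)
Lemma far_step (b alpha : R) : 0 < alpha -> alpha <= b -> b + alpha <= pi / 2 ->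
  N * p * sin alpha = 12 * a ->
  49 * (N * p) ^+ 2 * card_far (b + alpha) <= 64 * l ^+ 2 * card_far b.
Proof.
move=> al0 alb bal aE; set b' := b + alpha.
have pi0 := pi_ge0 R; have b0 : 0 <= b by rewrite (le_trans (ltW al0)).
have b'02 : 0 <= b' <= pi / 2 by rewrite bal addr_ge0// ltW.
have b02 : 0 <= b <= pi / 2 by rewrite b0 (le_trans _ bal)// lerDl ltW.
have sin_mono x : alpha <= x -> x <= pi / 2 -> sin alpha <= sin x.
  move=> ax x2; rewrite leNgt ltr_sin ?in_itv /= -?leNgt//; lra.
set S := far b'; set C := far b; set v := fun k => ind S k * excess b' k.
set m' := card_far b'; set m := card_far b.
have m'0 : 0 <= m' by exact: card_far_ge0.
have m0 : 0 <= m by exact: card_far_ge0.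
have N0 : 0 < N :> R by rewrite ltr0n.
have np0 : 0 < N * p by rewrite mulr_gt0.
have SC j : S j -> C j by apply: far_mono => //; rewrite ?lerDl ?(ltW al0)//; lra.
have mN : 48 * m <= N.
  by apply: card_far_chebyshev => //; rewrite -aE ler_pM2l//; apply: sin_mono; lra.
have H1 : sin alpha * form A (ind S) (ind (predC C)) <= form A (ind S) v.
  rewrite mulr_sumr; apply: ler_sum => j _; rewrite [ind S j]/ind.
  have [Sj|Sj] := boolP (S j); last by rewrite !mul0r mulr0.
  by rewrite !mul1r; apply: far_local => //; rewrite ?ltW.
have V1 : dot v v <= m'.
  apply: ler_sum => j _; rewrite /v /ind; have [Sj|Sj] := boolP (S j); last by rewrite !mul0r.
  have [/andP[e0 e1] _ _] := far_deviation b'02 Sj.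
  have : excess b' j * excess b' j <= 1 by nra.
  by rewrite !mul1r -/S Sj.
have D1 : form DA (ind S) v <= a * m'.
  have am' : 0 <= a * m' by rewrite mulr_ge0// ltW.
  apply: le_trans (ler_norm _) _; rewrite -ler_sqr ?nnegrE// real_normK ?num_real//.
  apply: le_trans (form_spectral_norm _ _ DeltaA_sym) _; rewrite dot_ind -[\sum_j ind S j]/m'.
  have := ler_wpM2l (mulr_ge0 (sqr_ge0 a) m'0) V1; lra.
set V := \sum_j v j.
have V0 : 0 <= V.
  apply: sumr_ge0 => j _; rewrite /v /ind; have [Sj|Sj] := boolP (S j); last by rewrite mul0r.
  by rewrite mul1r; have [/andP[->]] := far_deviation b'02 Sj.
(* Both [sin b'] and the excess of [k] are at most [|q k| / (p * r)]. *)
have VQ : (p * r) ^+ 2 * sin b' * V <= a ^+ 2 * N.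
  apply: le_trans sum_deviation; rewrite mulr_sumr; apply: ler_sum => j _.
  rewrite /v /ind; have [Sj|Sj] := boolP (S j); last by rewrite mul0r mulr0 deviation_ge0.
  have [_ q1 q2] := far_deviation b'02 Sj; rewrite mul1r.
  exact: mul_le_of_sqr (sqr_ge0 _) q1 q2.
have pV : 4 * (p * V) <= a.
  have sb : sin alpha <= sin b' by apply: sin_mono => //; rewrite lerDr.
  have u3 : 4 * a * (N * p) <= (p * r) ^+ 2 * sin b'.
    have -> : 4 * a * (N * p) = (N * p) ^+ 2 * sin alpha / 3.
      by rewrite expr2 -[_ * sin alpha]mulrA aE; field.
    have [_ sb0] := quadrant b'02.
    have sa0 : 0 <= sin alpha by apply: sin_ge0_pi; lra.
    have := ler_wpM2l (sqr_ge0 (p * r)) sb; have := ler_wpM2r sa0 mean_field_large.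
    rewrite [(N * p) ^+ 2]exprMn; lra.
  have aN : 0 < a * N by rewrite mulr_gt0.
  rewrite -(ler_pM2l aN); have := ler_wpM2r V0 u3; lra.
have H2 : 12 * form A (ind S) (ind (predC C)) <= 5 / 4 * (N * p) * m'.
  rewrite -(ler_pM2l a_gt0).
  have : form A (ind S) v <= 5 / 4 * (a * m').
    rewrite form_DeltaA -/V -[\sum_j ind S j]/m'; have := ler_wpM2r m'0 pV; lra.
  move=> /(le_trans H1)/(ler_wpM2l (ltW np0)); rewrite mulrA aE; lra.
have H3 := form_disjoint SC; rewrite -[\sum_j ind S j]/m' -[\sum_j ind C j]/m in H3.
have pm' : 0 <= p * m' by rewrite mulr_ge0// ltW.
(* The far set [C] has at most [N / 48] elements: 12 * 47/48 - 5/4 = 10.5, and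
   10.5 / 12 = 7 / 8. *)
have H4 : 7 * (N * p) * m' <= - 8 * form DL (ind S) (ind C).
  have := ler_wpM2l pm' mN; move: H2; rewrite H3; lra.
have [m'z|m'z] := eqVneq m' 0; first by rewrite m'z mulr0 mulr_ge0// mulr_ge0 ?sqr_ge0.
have m'p : 0 < m' by rewrite lt_def m'z.
rewrite -(ler_pM2r m'p).
have := form_spectral_norm (ind S) (ind C) DeltaL_sym; rewrite !dot_ind.
rewrite -[\sum_j ind S j]/m' -[\sum_j ind C j]/m; apply: square_balance H4.
by rewrite !mulr_ge0// ltW.
Qed.

(** Multiplying the equilibrium equations by [t j = tan (theta j)] and summing
    gives a vanishing sum of nonnegative terms, one for each edge, so that [t]
    is constant along edges; the spectral gap [n * p - |DeltaL| > 0] of the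
    Laplacian makes it constant. *)
Lemma in_phase_of_cos_gt0 : (forall j, 0 < c j) -> all_in_phase theta.
Proof.
move=> c0; pose t j := s j / c j.
have st j : s j = t j * c j by rewrite divfK// gt_eqF.
pose W j k := A j k * (c j * c k).
have H : \sum_j \sum_k W j k * (t j - t k) ^+ 2 = 0.
  have E1 : \sum_j \sum_k W j k * (t j * (t k - t j)) = 0.
    rewrite big1// => j _.
    have -> : \sum_k W j k * (t j * (t k - t j)) = t j * kuramoto A theta j.
      rewrite mulr_sumr; apply: eq_bigr => k _.
      by rewrite sinB [sin (theta k)]st [sin (theta j)]st /W; ring.
    by rewrite equi mulr0.
  have E2 : \sum_j \sum_k W j k * (t k * (t j - t k)) = 0.
    rewrite exchange_big -[RHS]E1; apply: eq_bigr => j _; apply: eq_bigr => k _.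
    by rewrite /W (sym_entry _ _ sA) [c k * _]mulrC.
  rewrite -[LHS]addr0 -{1}[X in _ + X]E1 -[LHS]addr0 -{1}[X in _ + X]E2.
  rewrite -!big_split big1// => j _; rewrite -!big_split big1// => k _ /=; ring.
have W0 j k : W j k * (t j - t k) ^+ 2 = 0.
  have P i i' : 0 <= W i i' * (t i - t i') ^+ 2.
    by rewrite mulr_ge0 ?sqr_ge0// mulr_ge0// mulr_ge0// ltW.
  have /psumr_eq0P := H => /(_ (fun i _ => sumr_ge0 _ (fun i' _ => P i i'))) /(_ j isT).
  by move/psumr_eq0P => /(_ (fun i' _ => P j i')) /(_ k isT).
have At j k : A j k * (t j - t k) = 0.
  have /eqP := W0 j k; rewrite /W mulf_eq0 sqrf_eq0 !mulf_eq0.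
  rewrite (gt_eqF (c0 j)) (gt_eqF (c0 k)) !orbF -mulf_eq0 => /eqP //.
pose mu := (\sum_j t j) / N.
have N0 : 0 < N :> R by rewrite ltr0n.
pose y j := t j - mu.
have Ly j : mxapp (lapmx A) y j = 0.
  rewrite mxapp_lapmx big1// => k _; rewrite /y -[RHS](At j k); ring.
have Sy : \sum_j y j = 0.
  rewrite sumrB sumr_const card_ord -[_ *+ n]mulr_natr divfK ?gt_eqF// subrr//.
have y0 j : y j = 0.
  apply: (@dot_eq0 _ _ y); have := form_lapmx y y.
  rewrite {1}/form [dot _ _]big1 => [|i _]; last by rewrite Ly mulr0.
  rewrite Sy !mulr0 subr0 => E.
  have := form_le_spectral_norm y DeltaL_sym; rewrite ler_norml => /andP[K _].
  have l0 := spectral_norm_ge0 DL; have d0 := dot_ge0 y.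
  have {K} : (N * p - l) * dot y y <= 0 by rewrite mulrBl; lra.
  rewrite pmulr_rle0; last by rewrite subr_gt0 (le_lt_trans _ l_lt)// ler_peMl// ler1n.
  by move=> dn; apply/eqP; rewrite eq_le dn d0.
have tt j k : t j = t k by have := y0 j; have := y0 k; rewrite /y; lra.
move=> j k; apply: sin0_cos_gt0.
  by rewrite sinB [sin (theta k)]st [sin (theta j)]st (tt j k); ring.
rewrite cosB [sin (theta k)]st [sin (theta j)]st (tt j k).
have -> : c j * c k + t k * c j * (t k * c k) = c j * c k * (1 + t k ^+ 2) by ring.
by rewrite mulr_gt0 ?mulr_gt0 ?ltr_pwDl ?sqr_ge0.
Qed.

(** Each step gains [(7 * n * p / (8 * |DeltaL|)) ^+ 2], which is at least
    [g] (step_gain). *)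
Lemma far_iter (alpha g : R) m : 0 < alpha -> N * p * sin alpha = 12 * a ->
  0 < l -> 0 < g -> 2 * l * (g + 1) <= N * p -> m.+1%:R * alpha <= pi / 2 ->
  48 * (card_far (m.+1%:R * alpha) * g ^+ m) <= N.
Proof.
move=> al0 aE l0 g0 gl; elim: m => [|m IH] mal.
  rewrite mul1r expr0 mulr1; apply: card_far_chebyshev; rewrite ?aE//.
  by move: mal; rewrite mul1r => ->; rewrite ltW.
have E : m.+2%:R * alpha = m.+1%:R * alpha + alpha by rewrite -[in LHS]addn1 natrD mulrDl mul1r.
have alm : alpha <= m.+1%:R * alpha by rewrite ler_peMl ?(ltW al0)// ler1n.
have {}IH : 48 * (card_far (m.+1%:R * alpha) * g ^+ m) <= N.
  by apply: IH; apply: le_trans mal; rewrite E lerDl ltW.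
rewrite E in mal *.
have := far_step al0 alm mal aE.
set x' := card_far _; set x := card_far _ in IH * => H.
have x'0 : 0 <= x' by exact: card_far_ge0.
have gx : g * x' <= x := step_gain l0 g0 x'0 gl H.
apply: le_trans IH; rewrite ler_pM2l// exprS mulrCA mulrA.
by rewrite ler_wpM2r// exprn_ge0// ltW.
Qed.

(** The number of steps [m.+1] is the integer part of [(pi / 2) / alpha], that is,
    of twice [pi / 4 / alpha]; so [m] exceeds
    [2 * ln (n / 6) / ln g], and [g ^+ m > (n / 6) ^+ 2] reduces the initial
    [n / 48] to less than one vertex. *)
Lemma far_eventually_empty (alpha g : R) : 0 < alpha -> alpha <= pi / 2 ->
  N * p * sin alpha = 12 * a ->
  0 < l -> 1 < g -> 2 * l * (g + 1) <= N * p ->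
  ln (N / 6) / ln g + 1 < pi / 4 / alpha ->
  forall j, 0 < c j.
Proof.
move=> al0 al2 aE l0 g1 gl K j; have N0 : 0 < N :> R by rewrite ltr0n.
have g0 : 0 < g := lt_trans ltr01 g1.
pose X := pi / 2 / alpha.
have X1 : 1 <= X by rewrite ler_pdivlMr// mul1r.
have /andP[] := Num.Theory.truncn_itv (le_trans ler01 X1).
case: (Num.truncn X) => [|m] mX Xm; first by move: X1; rewrite leNgt Xm.
have mal : m.+1%:R * alpha <= pi / 2 by rewrite -ler_pdivlMr.
have H := far_iter al0 aE l0 g0 gl mal.
have lg : 0 < ln g by rewrite ln_gt0.
have gm : (N / 6) ^+ 2 < g ^+ m.
  rewrite -ltr_ln ?posrE ?exprn_gt0 ?divr_gt0//.
  rewrite !lnXn ?divr_gt0// -[_ *+ 2]mulr_natr -[_ *+ m]mulr_natr.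
  rewrite -ltr_pdivrMl//.
  have -> : (ln g)^-1 * (ln (N / 6) * 2) = 2 * (ln (N / 6) / ln g) by ring.
  have XE : X = 2 * (pi / 4 / alpha) by rewrite /X; field; rewrite gt_eqF.
  suff : 2 * (ln (N / 6) / ln g) < m%:R :> R by [].
  have {}Xm : X < m%:R + 2 :> R by rewrite -natrD addn2.
  by rewrite XE in Xm; exact: double_lt K Xm.
rewrite ltNge; apply/negP => cj.
have fj : far (m.+1%:R * alpha) j.
  apply: le_trans cj _; apply: (quadrant _).1.
  by rewrite mal mulr_ge0// ltW.
have c1 : 1 <= card_far (m.+1%:R * alpha).
  rewrite /card_far (bigD1 j)//= /ind fj lerDl.
  by apply: sumr_ge0 => k _; rewrite ler0n.
have N1 : 1 <= N :> R by rewrite ler1n.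
by case: (count_absurd N1 c1 gm H).
Qed.

End Combinatorics.

(** * Differential inequalities and limits *)

Section Calculus.
Variable R : realType.
Local Open Scope classical_set_scope.
Local Open Scope ring_scope.
Implicit Types (f df g : R -> R) (a b t : R).

Lemma le_of_derive_ge0 f df a b : a <= b ->
  {within `[a, b], continuous f} ->
  (forall t, a < t < b -> is_derive t 1 f (df t)) ->
  (forall t, a < t < b -> 0 <= df t) -> f a <= f b.
Proof.
rewrite le_eqVlt => /predU1P[->//|ab] cf Df df0.
have D t : t \in `]a, b[%R -> is_derive t 1 f (df t) by rewrite in_itv; exact: Df.
have [c cab E] := MVT ab D cf.
by rewrite -subr_ge0 E mulr_ge0 ?subr_ge0 ?(ltW ab)// df0// -[_ < _ < _]/(c \in `]a, b[).
Qed.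

Lemma is_derive_continuous f (d t : R) : is_derive t 1 f d -> {for t, continuous f}.
Proof. by move=> D; apply/differentiable_continuous/derivable1_diffP; exact: ex_derive. Qed.

Lemma continuous_within f a b : (forall t, a <= t <= b -> {for t, continuous f}) ->
  {within `[a, b], continuous f}.
Proof.
move=> cf; apply: continuous_in_subspaceT => t.
by rewrite inE /= in_itv /= => tab; exact: cf.
Qed.

(** The integral starts at -1 so that the derivative at 0 is two-sided. *)
Lemma primitive_exists f : continuous f ->
  exists G : R -> R, G 0 = 0 /\ forall t : R, 0 <= t -> is_derive t 1 G (f t).
Proof.
move=> cf; pose I (t : R) := (\int[lebesgue_measure]_(s in `[(-1)%R, t]) f s)%R.
exists (fun t => I t - I 0); split; first by rewrite subrr.
move=> t t0.
have t1 : t < t + 1 by rewrite ltrDl.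
have m1 : -1 < t by rewrite (lt_le_trans _ t0)// oppr_lt0.
have int : lebesgue_measure.-integrable `[(-1)%R, t + 1] (EFin \o f).
  apply: continuous_compact_integrable; first exact: segment_compact.
  exact: continuous_subspaceT.
have [D E] := continuous_FTC1_closed t1 int m1 (cf t).
have DI : is_derive t 1 I (f t) by rewrite -E derive1E; exact: derivableP.
by rewrite -[f t]subr0; apply: is_deriveB.
Qed.

Lemma is_derive_exp_linear (C M t : R) :
  is_derive t 1 (fun t => C * expR (M * t)) (C * (M * expR (M * t))).
Proof.
have D : is_derive t 1 (fun t : R => M * t) M.
  by rewrite -[X in is_derive _ _ _ X](mulr1 M); apply: is_deriveZ.
have := @is_derive1_comp R expR (fun t : R => M * t) t (expR (M * t)) M _ D.
move=> /(_ (is_derive_expR _)) D2.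
by rewrite [M * _]mulrC; apply: is_deriveZ.
Qed.

(** [C * expR (M * t) - f t] and [C * expR (M * t) + f t] start at [C >= 0] and
    do not decrease. *)
Lemma exp_growth_bound f df (C M : R) :
  f 0 = 0 -> 0 <= C -> (forall t : R, 0 <= t -> is_derive t 1 f (df t)) ->
  (forall t : R, 0 <= t -> `|df t| <= C * (M * expR (M * t))) ->
  forall t : R, 0 <= t -> `|f t| <= C * expR (M * t).
Proof.
move=> f0 C0 Df dfM t t0.
suff H g dg : g 0 = 0 -> (forall t : R, 0 <= t -> is_derive t 1 g (dg t)) ->
    (forall t : R, 0 <= t -> dg t <= C * (M * expR (M * t))) -> g t <= C * expR (M * t).
  rewrite ler_norml; apply/andP; split.
    rewrite lerNl; apply: (H (fun t => - f t) (fun t => - df t)).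
    - by rewrite f0 oppr0.
    - by move=> s s0; apply: is_deriveN; exact: Df.
    - by move=> s s0; rewrite (le_trans _ (dfM s s0))// -normrN ler_norm.
  apply: (H f df) => // s s0; exact: le_trans (ler_norm _) (dfM s s0).
move=> g0 Dg dgM.
pose k (t : R) := C * expR (M * t) - g t.
have Dk (s : R) : 0 <= s -> is_derive s 1 k (C * (M * expR (M * s)) - dg s).
  by move=> s0; apply: is_deriveB; [exact: is_derive_exp_linear | exact: Dg].
have : k 0 <= k t.
  apply: (@le_of_derive_ge0 k (fun s => C * (M * expR (M * s)) - dg s)).
  - exact: t0.
  - by apply: continuous_within => s /andP[s0 _]; apply: is_derive_continuous (Dk s s0).
  - by move=> s /andP[/ltW s0 _]; exact: Dk.
  - by move=> s /andP[/ltW s0 _]; rewrite subr_ge0 dgM.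
by rewrite /k g0 mulr0 expR0 subr0 mulr1 => /(le_trans C0); rewrite subr_ge0.
Qed.

Lemma geometric_small (E e : R) : 0 < e -> exists m : nat, E / 2 ^+ m < e.
Proof.
move=> e0; exists (Num.bound (E / e)).
rewrite ltr_pdivrMr ?exprn_gt0// mulrC -ltr_pdivrMr//.
exact: upper_nthrootP.
Qed.

(** The limit is the supremum of the increasing sequence [u m - 2 * K / 2 ^+ m];
    the sequence [u m + 2 * K / 2 ^+ m] decreases and bounds it from above. *)
Lemma geometric_limit (u : nat -> R) (K : R) :
  (forall m, `|u m.+1 - u m| <= K / 2 ^+ m) ->
  exists l : R, forall m, `|u m - l| <= 2 * K / 2 ^+ m.
Proof.
move=> uK; pose e m : R := 2 * K / 2 ^+ m.
have eS m : e m.+1 = e m - K / 2 ^+ m.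
  by rewrite /e exprS; field; rewrite expf_neq0.
have K0 : 0 <= K by have := uK 0; rewrite expr0 divr1; apply: le_trans.
have e0 m : 0 <= e m by rewrite divr_ge0 ?exprn_ge0// mulr_ge0.
have lo m k : u m - e m <= u (m + k)%N - e (m + k)%N.
  elim: k => [|k IH]; first by rewrite addn0.
  apply: le_trans IH _; rewrite addnS eS; have := uK (m + k)%N; rewrite ler_norml; lra.
have hi m k : u (m + k)%N + e (m + k)%N <= u m + e m.
  elim: k => [|k IH]; first by rewrite addn0.
  apply: le_trans IH; rewrite addnS eS; have := uK (m + k)%N; rewrite ler_norml; lra.
(* Comparable even when [m] and [k] differ, by monotonicity on either side. *)
have lohi m k : u m - e m <= u k + e k.
  have [mk|/ltnW km] := leqP m k.
    by have := lo m (k - m)%N; rewrite subnKC//; have := e0 k; lra.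
  by have := hi k (m - k)%N; rewrite subnKC//; have := e0 m; lra.
pose S := range (fun m => u m - e m).
exists (sup S) => m.
have l1 : u m - e m <= sup S.
  apply: ub_le_sup; last by exists m.
  by exists (u 0 + e 0) => _ [k _ <-].
have l2 : sup S <= u m + e m.
  apply: ge_sup; first by exists (u 0 - e 0), 0.
  by move=> _ [k _ <-].
by rewrite -/(e m) ler_norml; lra.
Qed.

End Calculus.

(** * Global solutions of Lipschitz differential equations *)

Section Picard.
Variables (R : realType) (n : nat).
Local Open Scope classical_set_scope.
Local Open Scope ring_scope.
Variable (F : ('I_n -> R) -> 'I_n -> R) (L : R).
Hypothesis L_gt0 : 0 < L.
Hypothesis F_lip : forall (x y : 'I_n -> R) (d : R),
  (forall j, `|x j - y j| <= d) -> forall j, `|F x j - F y j| <= L * d.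

Definition curve_continuous (x : R -> 'I_n -> R) := forall j, continuous (fun t => x t j).

Lemma field_continuous x : curve_continuous x -> curve_continuous (fun t => F (x t)).
Proof.
move=> cx j t; apply/cvgrPdist_lt => e e0.
have d0 : 0 < e / (2 * L) by rewrite divr_gt0// mulr_gt0.
have H : \forall s \near t, forall k, `|x t k - x s k| < e / (2 * L).
  apply: (@filter_forall R _ (fun k s => `|x t k - x s k| < e / (2 * L)) (nbhs t) _) => k.
  by have /cvgrPdist_lt/(_ _ d0) := cx k t.
near=> s.
have : forall k, `|x t k - x s k| <= e / (2 * L).
  by move=> k; apply: ltW; move: k; near: s.
move=> /F_lip/(_ j)/le_lt_trans; apply.
by rewrite (_ : L * _ = e / 2) ?ltr_pdivrMr ?ltr_pMr ?ltr1n//; field; rewrite gt_eqF.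
Unshelve. all: by end_near. Qed.

(** Replacing [t] by [Num.max t 0] extends a function given on the nonnegative
    half-line to the line, so that continuity can be stated without reference to
    a subspace. *)
Lemma freeze_continuous (f : R -> R) : (forall t : R, 0 <= t -> {for t, continuous f}) ->
  continuous (fun t : R => f (Num.max t 0)).
Proof.
move=> cf t; apply: (@continuous_comp _ _ _ (fun t : R => Num.max t 0) f).
  by apply: (@continuous_max R R^o id (cst 0)); [exact: cvg_id | exact: cvg_cst].
by apply: cf; rewrite le_max lexx orbT.
Qed.

Variable x0 : 'I_n -> R.

Definition prim (f : R -> R) : R -> R :=
  xget (fun=> 0) [set G : R -> R | G 0 = 0 /\ forall t : R, 0 <= t -> is_derive t 1 G (f t)].

Lemma primP f : continuous f ->
  prim f 0 = 0 /\ forall t : R, 0 <= t -> is_derive t 1 (prim f) (f t).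
Proof. by move=> /primitive_exists [G HG]; rewrite /prim; case: xgetP => [G' _//|/(_ G)]. Qed.

(** Constant for [t <= 0], so that the iterates are continuous on the whole line. *)
Definition picard (x : R -> 'I_n -> R) : R -> 'I_n -> R :=
  fun t j => x0 j + prim (fun s => F (x s) j) (Num.max t 0).

Lemma picard_continuous x : curve_continuous x -> curve_continuous (picard x).
Proof.
move=> cx j; have [_ D] := primP (@field_continuous x cx j).
move=> t; apply: cvgD; first exact: cvg_cst.
by apply: freeze_continuous => s s0; exact: is_derive_continuous (D s s0).
Qed.

(** The norm weighted by [expR (2 * L * t)] makes the Picard operator a
    contraction with factor 1/2 on the whole half-line: integrating the Lipschitz
    bound [L * K * expR (2 * L * s)] divides by [2 * L]. *)
Lemma picard_contract x y (K : R) : curve_continuous x -> curve_continuous y ->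
  (forall (t : R) j, 0 <= t -> `|x t j - y t j| <= K * expR (2 * L * t)) ->
  forall (t : R) j, 0 <= t -> `|picard x t j - picard y t j| <= K / 2 * expR (2 * L * t).
Proof.
move=> cx cy xy t j t0.
have [px Dx] := primP (@field_continuous x cx j).
have [py Dy] := primP (@field_continuous y cy j).
have K0 : 0 <= K.
  by have := xy 0 j (lexx 0); rewrite mulr0 expR0 mulr1; exact: le_trans.
rewrite /picard (max_idPl t0) opprD addrACA subrr add0r.
apply: (@exp_growth_bound R (fun t => prim (fun s => F (x s) j) t - prim (fun s => F (y s) j) t)
   (fun t => F (x t) j - F (y t) j)) => //.
- by rewrite px py subrr.
- by rewrite divr_ge0.
- by move=> s s0; apply: is_deriveB; [exact: Dx|exact: Dy].
move=> s s0; apply: le_trans (F_lip (fun k => xy s k s0) j) _.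
by rewrite le_eqVlt; apply/orP; left; apply/eqP; field.
Qed.

Fixpoint iterate m : R -> 'I_n -> R :=
  if m is m'.+1 then picard (iterate m') else fun=> x0.

Lemma iterate_continuous m : curve_continuous (iterate m).
Proof. by elim: m => [j t|m IH]; [exact: cvg_cst | exact: picard_continuous]. Qed.

Lemma iterate_step : exists2 K : R, 0 <= K & forall m (t : R) j, 0 <= t ->
  `|iterate m.+1 t j - iterate m t j| <= K * expR (2 * L * t) / 2 ^+ m.
Proof.
pose B := \sum_j `|F x0 j|; exists (B / (2 * L)).
  by rewrite divr_ge0 ?mulr_ge0 ?(ltW L_gt0)// sumr_ge0.
elim=> [|m IH] t j t0.
  have c0 : curve_continuous (fun=> x0) by move=> k s; exact: cvg_cst.
  have [p D] := primP (@field_continuous _ c0 j).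
  rewrite expr0 divr1 /= /picard (max_idPl t0) addrAC subrr add0r.
  apply: (@exp_growth_bound R _ (fun=> F x0 j)) => //.
    by rewrite divr_ge0 ?mulr_ge0 ?(ltW L_gt0)// sumr_ge0.
  move=> s s0.
  rewrite (_ : B / (2 * L) * _ = B * expR (2 * L * s)); last by field; rewrite gt_eqF.
  apply: (@le_trans _ _ B).
    by rewrite /B (bigD1 j)//= lerDl sumr_ge0.
  rewrite ler_peMr ?sumr_ge0//; apply: le_trans (expR_ge1Dx _).
  by rewrite lerDl !mulr_ge0 ?(ltW L_gt0).
have := @picard_contract (iterate m.+1) (iterate m) (B / (2 * L) / 2 ^+ m)
  (@iterate_continuous m.+1) (@iterate_continuous m).
move=> /(_ _ t j t0) H; apply: le_trans (H _) _.
  by move=> s k s0; apply: le_trans (IH s k s0) _; rewrite mulrAC.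
rewrite exprS le_eqVlt; apply/orP; left; apply/eqP; field.
by rewrite expf_neq0//= gt_eqF.
Qed.

(** Convergence is uniform on bounded intervals, so the limit is continuous. *)
Lemma iterate_limit : exists x : R -> 'I_n -> R, exists2 K : R, 0 <= K &
  curve_continuous x /\ forall m (t : R) j, 0 <= t ->
  `|iterate m t j - x t j| <= 2 * K * expR (2 * L * t) / 2 ^+ m.
Proof.
have [K K0 HK] := iterate_step.
have /choice [y yP] : forall t : R, exists l : 'I_n -> R, forall j m,
   0 <= t -> `|iterate m t j - l j| <= 2 * (K * expR (2 * L * t)) / 2 ^+ m.
  move=> t; have [t0|t0] := leP 0 t; last by exists x0.
  have /choice [l lP] : forall j, exists l : R, forall m,
      `|iterate m t j - l| <= 2 * (K * expR (2 * L * t)) / 2 ^+ m.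
    by move=> j; apply: geometric_limit => m; exact: HK.
  by exists l => j m _.
pose x t := y (Num.max t 0); exists x, K => //.
have it m t j : iterate m t j = iterate m (Num.max t 0) j.
  by case: m => [//|m] /=; rewrite /picard -maxA maxxx.
have xP m t j : `|iterate m t j - x t j| <= 2 * (K * expR (2 * L * Num.max t 0)) / 2 ^+ m.
  by rewrite it; apply: yP; rewrite le_max lexx orbT.
split; last by move=> m t j t0; have := xP m t j; rewrite (max_idPl t0) mulrA.
move=> j t; apply/cvgrPdist_lt => e e0.
pose E := 2 * (K * expR (2 * L * Num.max (t + 1) 0)).
have E0 : 0 <= E by rewrite !mulr_ge0 ?expR_ge0.
have [m Em] : exists m, E / 2 ^+ m < e / 3.
  by apply: geometric_small; rewrite divr_gt0.
have bd (s : R) : s <= t + 1 -> `|iterate m s j - x s j| < e / 3.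
  move=> st; apply: le_lt_trans (xP m s j) (le_lt_trans _ Em).
  rewrite ler_pM2r ?invr_gt0 ?exprn_gt0// ler_pM2l// ler_wpM2l// ler_expR.
  by rewrite ler_pM2l ?mulr_gt0// ge_max le_max st /= le_max lexx orbT.
have /cvgrPdist_lt/(_ (e / 3)) := @iterate_continuous m j t.
rewrite divr_gt0// => /(_ isT) ct.
have /cvgrPdist_lt/(_ 1 ltr01) idt : s @[s --> t] --> t by exact: cvg_id.
near=> s.
have st : s <= t + 1.
  have : `|t - s| < 1 by near: s.
  by rewrite ltr_norml; lra.
have s1 : `|iterate m t j - iterate m s j| < e / 3 by near: s.
have := bd s st; have := bd t; rewrite lerDl ler01 => /(_ isT).
move: s1; rewrite !ltr_norml; lra.
Unshelve. all: by end_near. Qed.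

(** The solution is given as [x0] plus a primitive, and not as the limit of the
    iterates, because the former has a two-sided derivative at 0 as well. *)
Lemma ode_exists : exists x : R -> 'I_n -> R, x 0 = x0 /\
  forall (t : R) j, 0 <= t -> is_derive t 1 (fun s => x s j) (F (x t) j).
Proof.
have [y [K K0 [cy yP]]] := iterate_limit.
have fix_y t j : 0 <= t -> picard y t j = y t j.
  move=> t0; apply/eqP; rewrite -subr_eq0 -normr_eq0; apply/eqP.
  pose E := 4 * K * expR (2 * L * t).
  have E0 : 0 <= E by rewrite !mulr_ge0 ?expR_ge0.
  have H m : `|picard y t j - y t j| <= E / 2 ^+ m.
    have h1 := yP m.+1 t j t0.
    have h2 : `|iterate m.+1 t j - picard y t j| <= 2 * K / 2 ^+ m / 2 * expR (2 * L * t).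
      apply: picard_contract => //; first exact: iterate_continuous.
      by move=> s k s0; apply: le_trans (yP m s k s0) _; rewrite mulrAC.
    have -> : E / 2 ^+ m = 2 * K / 2 ^+ m / 2 * expR (2 * L * t) + 2 * K * expR (2 * L * t) / 2 ^+ m.+1 + 2 * (K * expR (2 * L * t) / 2 ^+ m).
      by rewrite /E exprS; field; rewrite expf_neq0.
    have h3 : 0 <= K * expR (2 * L * t) / 2 ^+ m.
      by rewrite divr_ge0 ?exprn_ge0 ?mulr_ge0 ?expR_ge0.
    by move: h1 h2; rewrite !ler_norml; lra.
  apply/eqP; rewrite eq_le normr_ge0 andbT; apply/ler_addgt0Pr => e e0.
  have [m Em] : exists m, E / 2 ^+ m < e by exact: geometric_small.
  by rewrite add0r (le_trans (H m))// ltW.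
exists (fun t j => x0 j + prim (fun s => F (y s) j) t); split.
  by apply/funext => j; rewrite (primP (@field_continuous y cy j)).1 addr0.
move=> t j t0.
have -> : (fun j => x0 j + prim (fun s => F (y s) j) t) = y t.
  by apply/funext => k; rewrite -fix_y// /picard (max_idPl t0).
rewrite -[F (y t) j]add0r; apply: is_deriveD.
exact: (primP (@field_continuous y cy j)).2.
Qed.

End Picard.

(** * Stability of the in-phase state *)

Section Stability.
Variables (R : realType) (n : nat).
Local Open Scope classical_set_scope.
Local Open Scope ring_scope.
Implicit Types (A M : 'M[R]_n) (theta : 'I_n -> R).

Lemma is_derive_sumf (I : finType) (h : I -> R -> R) (dh : I -> R) (t : R) :
  (forall i, is_derive t 1 (h i) (dh i)) ->
  is_derive t 1 (fun s => \sum_i h i s) (\sum_i dh i).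
Proof.
move=> H; rewrite /index_enum; elim: (Finite.enum _) => [|i s IH].
  rewrite big_nil; under eq_fun do rewrite big_nil; exact: is_derive_cst.
rewrite big_cons; under eq_fun do rewrite big_cons; exact: is_deriveD.
Qed.

Lemma is_derive_form M (u : R -> 'I_n -> R) (du : 'I_n -> R) (t : R) :
  (forall j, is_derive t 1 (fun s => u s j) (du j)) ->
  is_derive t 1 (fun s => form M (u s) (u s)) (form M (u t) du + form M du (u t)).
Proof.
move=> Du.
rewrite /form /dot -big_split /=; apply: is_derive_sumf => j.
have -> : u t j * mxapp M du j + du j * mxapp M (u t) j =
    u t j *: mxapp M du j + mxapp M (u t) j *: du j by rewrite [du j * _]mulrC.
by apply: is_deriveM; apply: is_derive_sumf => k; exact: is_deriveZ.
Qed.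

(** The counterpart of freeze_continuous for functions that are only known to be
    continuous relative to the half-line, as solutions are at 0. *)
Lemma freeze_within (f : R -> R) : {within `[0, +oo[, continuous f} ->
  continuous (fun t : R => f (Num.max t 0)).
Proof.
move=> /subspace_continuousP cf t; set m := Num.max t 0.
have m0 : `[0, +oo[%classic m by rewrite /= in_itv /= andbT le_max lexx orbT.
have cm : (fun s : R => Num.max s 0) s @[s --> t] --> m.
  by apply: (@continuous_max R R^o id (cst 0)); [exact: cvg_id | exact: cvg_cst].
apply/cvgrPdist_lt => e e0.
have /cvgrPdist_lt/(_ e e0) := cf m m0; rewrite near_withinE => H.
have {}H : \forall s \near t, `[0, +oo[%classic (Num.max s 0) -> `|f m - f (Num.max s 0)| < e.
  exact: cm _ H.
near=> s; have : `[0, +oo[%classic (Num.max s 0) -> `|f m - f (Num.max s 0)| < e by near: s.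
by apply; rewrite /= in_itv /= andbT le_max lexx orbT.
Unshelve. all: by end_near. Qed.

(** At the first time [t0] at which the value [c] is reached, [f] has been
    nonincreasing on [[0, t0]] and hence is at most [f 0 < c]. *)
Lemma trapped (f df : R -> R) (c : R) :
  continuous (fun t : R => f (Num.max t 0)) ->
  (forall t : R, 0 < t -> is_derive t 1 f (df t)) ->
  f 0 < c -> (forall t, 0 < t -> f t <= c -> df t <= 0) ->
  forall t, 0 <= t -> f t < c.
Proof.
move=> cg Df f0 dfc T T0; rewrite ltNge; apply/negP => fT.
pose g t := f (Num.max t 0).
pose S := [set t | 0 <= t /\ c <= f t].
have infS : has_inf S by split; [exists T | exists 0 => t []].
pose t0 := inf S.
have t00 : 0 <= t0 by apply: lb_le_inf; [exists T | move=> t []].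
have before t : 0 <= t -> t < t0 -> f t < c.
  move=> tp; rewrite !ltNge; apply: contra => ft.
  by apply: ge_inf; [exists 0 => s [] | split].
have gt0 : g t0 = f t0 by rewrite /g (max_idPl t00).
have ft0 : c <= f t0.
  rewrite leNgt; apply/negP => ft0.
  have e0 : 0 < c - f t0 by rewrite subr_gt0.
  have /cvgrPdist_lt/(_ _ e0) := cg t0; rewrite -/(g t0) gt0 => -[d /= d0 Hd].
  have [t [tp ft] tt0] := inf_adherent d0 infS.
  have t0t : t0 <= t by apply: ge_inf; [exists 0 => s [] | split].
  have : `|f t0 - f (Num.max t 0)| < c - f t0.
    by apply: Hd; rewrite /ball /= distrC ger0_norm ?subr_ge0// ltrBlDl.
  by rewrite (max_idPl tp) ltr_norml; lra.
have : - g 0 <= - g t0.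
  apply: (@le_of_derive_ge0 R (fun t => - g t) (fun t => - df t)) => //.
  - by apply: continuous_subspaceT => t; apply: cvgN; exact: cg.
  - move=> t /andP[tp _]; apply: is_deriveN.
    apply: near_eq_is_derive (Df t tp); near=> s.
    have s0 : 0 <= s by near: s; exact: lt_le_nbhsr.
    by rewrite /g (max_idPl s0).
  - by move=> t /andP[tp /(before _ (ltW tp))/ltW]; rewrite oppr_ge0; exact: dfc.
by rewrite lerN2 gt0 /g maxxx; lra.
Unshelve. all: by end_near. Qed.

Lemma all_in_phase_equilibrium A theta : all_in_phase theta -> equilibrium A theta.
Proof.
move=> th j; rewrite /kuramoto big1// => k _.
by have [m ->] := th k j; rewrite -[_%:~R * _]add0r sin_shift sin0 mulr0.
Qed.

Lemma mulr_sin_ge0 (z : R) : `|z| <= pi -> 0 <= z * sin z.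
Proof.
wlog z0 : z / 0 <= z => [H|].
  have [z0|z0] := leP 0 z; first exact: H.
  by rewrite -normrN -mulrNN -sinN; apply: H; rewrite oppr_ge0 ltW.
by rewrite ger0_norm// => zp; rewrite mulr_ge0// sin_ge0_pi// z0.
Qed.

(** By the symmetry of [A], twice the left-hand side is minus the sum of the
    [A j k * (u j - u k) * sin (u j - u k)], and [|u j - u k| <= 2 <= pi]. *)
Lemma kuramoto_dissipative A (u : 'I_n -> R) : A^T = A -> (forall j k, 0 <= A j k) ->
  (forall j, `|u j| <= 1) -> dot u (kuramoto A u) <= 0.
Proof.
move=> sA A0 u1.
have E1 : dot u (kuramoto A u) = \sum_j \sum_k A j k * (u j * sin (u k - u j)).
  by apply: eq_bigr => j _; rewrite mulr_sumr; apply: eq_bigr => k _; rewrite mulrCA.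
have E2 : dot u (kuramoto A u) = \sum_j \sum_k A j k * (- u k * sin (u k - u j)).
  rewrite E1 exchange_big; apply: eq_bigr => j _; apply: eq_bigr => k _.
  by rewrite (sym_entry _ _ sA) -[in LHS]opprB sinN mulrN mulNr.
have : dot u (kuramoto A u) + dot u (kuramoto A u) <= 0; last lra.
rewrite {1}E1 E2 -big_split /= -oppr_ge0 -sumrN; apply: sumr_ge0 => j _.
rewrite -big_split /= -sumrN; apply: sumr_ge0 => k _.
rewrite -mulrDr -mulrDl -mulrN -mulNr opprD opprK addrC mulr_ge0// mulr_sin_ge0//.
have := u1 j; have := u1 k; have := pi_ge2 R; rewrite !ler_norml; lra.
Qed.

(** Each phase is lifted to its representative [u j] near 0, relative to [theta].
    The sum of squares of the [u j] does not increase while it is at most 1. *)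
Lemma all_in_phase_stable A theta : A^T = A -> (forall j k, 0 <= A j k) ->
  all_in_phase theta -> lyapunov_stable A theta.
Proof.
move=> sA A0 th eps eps0.
pose eta := Num.min eps 1.
have eta0 : 0 < eta by rewrite lt_min eps0 ltr01.
have n1 : 0 < n%:R + 1 :> R by rewrite ltr_wpDl.
exists (eta / (n%:R + 1)); first by rewrite divr_gt0.
move=> x sol /choice[m mP].
pose u t j := x t j - theta j - (m j)%:~R * (2 * pi).
have Du (t : R) j : 0 < t -> is_derive t 1 (fun s => u s j) (kuramoto A (u t) j).
  move=> t0; have [_ /(_ t t0) D] := sol j.
  have -> : kuramoto A (u t) j = kuramoto A (x t) j - 0 - 0.
    rewrite !subr0; apply: eq_bigr => k _; congr (_ * _).
    have [i E] := th k j.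
    rewrite -[RHS](sin_shift _ (m j - m k - i)); congr sin.
    by rewrite /u !intrB mulrBl mulrBl -E; ring.
  apply: is_deriveB; apply: is_deriveB.
have V0 : dot (u 0) (u 0) < eta ^+ 2.
  apply: (@le_lt_trans _ _ (n%:R * (eta / (n%:R + 1)) ^+ 2)).
    rewrite mulr_natl -[X in _ *+ X]card_ord -sumr_const; apply: ler_sum => j _.
    rewrite -expr2 -[X in X <= _]real_normK ?num_real// ler_sqr ?nnegrE ?divr_ge0 ?(ltW eta0) ?(ltW n1)//.
    exact: ltW (mP j).
  rewrite expr_div_n mulrA ltr_pdivrMr ?exprn_gt0// mulrC ltr_pM2l ?exprn_gt0//.
  by have := ler0n R n; nra.
have H := @trapped (fun t => dot (u t) (u t)) (fun t => 2 * dot (u t) (kuramoto A (u t))) (eta ^+ 2).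
have {}H (t : R) : 0 <= t -> dot (u t) (u t) < eta ^+ 2.
  apply: H => //.
  - have cu j : continuous (fun t : R => u (Num.max t 0) j).
      have [/freeze_within cx _] := sol j.
      by move=> s; apply: cvgB; [apply: cvgB; [exact: cx | exact: cvg_cst] | exact: cvg_cst].
    move=> s; apply: cvg_big => [|j _]; [exact: add_continuous | by apply: cvgM; exact: cu].
  - move=> s s0.
    have := is_derive_form 1%:M (fun j => Du s j s0).
    under eq_fun do rewrite form_scalar mul1r.
    by rewrite !form_scalar !mul1r [dot (kuramoto _ _) _]dotC -mulr2n mulr_natl.
  move=> s s0 Vs; rewrite pmulr_rle0//; apply: kuramoto_dissipative => // j.
  have := le_trans (sqr_le_dot (u s) j) Vs.
  rewrite -[u s j ^+ 2]real_normK ?num_real// ler_sqr ?nnegrE ?(ltW eta0)// => /le_trans; apply.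
  by rewrite ge_min lexx orbT.
move=> t t0 j; exists (m j); rewrite -/(u t j).
have := le_lt_trans (sqr_le_dot (u t) j) (H t t0).
rewrite -[u t j ^+ 2]real_normK ?num_real// ltr_sqr ?nnegrE ?(ltW eta0)// => /lt_le_trans; apply.
by rewrite ge_min lexx.
Qed.

End Stability.

(** * Linear instability implies instability *)

Section Instability.
Variables (R : realType) (n : nat).
Local Open Scope classical_set_scope.
Local Open Scope ring_scope.
Implicit Types (A M W : 'M[R]_n) (theta : 'I_n -> R).

Lemma form_lapmx_diff W (x : 'I_n -> R) : W^T = W ->
  2 * form (lapmx W) x x = \sum_j \sum_k W j k * (x j - x k) ^+ 2.
Proof.
move=> sW.
have E1 : form (lapmx W) x x = \sum_j \sum_k W j k * (x j * (x j - x k)).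
  by apply: eq_bigr => j _; rewrite mxapp_lapmx mulr_sumr; apply: eq_bigr => k _; rewrite mulrCA.
have E2 : form (lapmx W) x x = \sum_j \sum_k W j k * (- x k * (x j - x k)).
  rewrite E1 exchange_big; apply: eq_bigr => j _; apply: eq_bigr => k _.
  by rewrite (sym_entry _ _ sW); ring.
rewrite mulr_natl mulr2n {1}E1 E2 -big_split; apply: eq_bigr => j _.
by rewrite -big_split; apply: eq_bigr => k _ /=; ring.
Qed.

(** Of the [n.+1] numbers [c / k.+1] at most [n] are roots of the characteristic
    polynomial. *)
Lemma nonsingular_shift M (c : R) : M^T = M -> 0 < c ->
  exists s : R, [/\ 0 < s, s <= c & s%:M + M \in unitmx].
Proof.
move=> sM c0; pose rs := [seq c / k.+1%:R | k <- iota 0 n.+1].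
have : ~~ all (root (char_poly (- M))) rs.
  apply/negP => H.
  have p0 : char_poly (- M) != 0 by rewrite monic_neq0// char_poly_monic.
  have urs : uniq rs.
    rewrite map_inj_uniq ?iota_uniq// => i j /(mulfI (lt0r_neq0 c0))/invr_inj/eqP.
    by rewrite eqr_nat => /eqP [].
  by have := max_poly_roots p0 H urs; rewrite size_char_poly size_map size_iota ltnn.
rewrite -has_predC => /hasP[s /mapP[k _ ->]] /= nr.
exists (c / k.+1%:R); split; first by rewrite divr_gt0.
  by rewrite ler_pdivrMr// ler_peMr ?ler1n// ltW.
apply/negPn/negP => nu; move: nr; rewrite -eigenvalue_root_char => /negP; apply.
by apply: nonunit_eigenvalue; [rewrite linearN /= sM | rewrite opprK].
Qed.

(** A continuous path that is always close to a multiple of [2 * pi] stays close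
    to the same one: on the way to another multiple, [|f|] would take the value 1. *)
Lemma stays_near_lift (f : R -> R) (eps T : R) : 0 <= T -> eps <= 1 ->
  {within `[0, T], continuous f} -> `|f 0| < eps ->
  (forall t, 0 <= t <= T -> exists m : int, `|f t - m%:~R * (2 * pi)| < eps) ->
  `|f T| < eps.
Proof.
move=> T0 e1 cf f0 H.
have pi2 := pi_ge2 R.
have far_lift (m : int) (z : R) : m != 0 -> `|z - m%:~R * (2 * pi)| < eps -> 3 < `|z|.
  move=> m0 zm.
  have m1 : 1 <= `|m%:~R : R| by rewrite -intr_norm ler1z -gtz0_ge1 normr_gt0.
  have : 4 <= `|m%:~R * (2 * pi) : R|.
    by rewrite normrM [X in _ * X]ger0_norm; [nra | lra].
  have := ler_normB (m%:~R * (2 * pi) - z) (- z); rewrite opprK subrK normrN distrC; lra.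
have [m mT] := H T (introT andP (conj T0 (lexx T))).
have [m0|m0] := eqVneq m 0; first by move: mT; rewrite m0 mul0r subr0.
have fT := far_lift _ _ m0 mT.
have cnf : {within `[0, T], continuous (fun t => `|f t|)}.
  by move=> t; apply: cvg_norm; exact: cf.
have v1 : Num.min `|f 0| `|f T| <= 1 <= Num.max `|f 0| `|f T|.
  by rewrite ge_min le_max; apply/andP; split; apply/orP; [left|right]; lra.
have [c] := IVT T0 cnf v1; rewrite in_itv /= => cT fc.
have [i ic] := H c cT.
have [i0|i0] := eqVneq i 0; first by move: ic; rewrite i0 mul0r subr0 fc; lra.
have := far_lift _ _ i0 ic; rewrite fc; lra.
Qed.

(** One bound for all row sums, so that the Lipschitz constant and the remainder
    of the linearization do not depend on the vertex. *)
Definition weight A : R := \sum_j \sum_k `|A j k|.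

Lemma weight_ge0 A : 0 <= weight A.
Proof. by apply: sumr_ge0 => j _; apply: sumr_ge0. Qed.

Lemma row_weight A j (h : 'I_n -> R) (b : R) : 0 <= b -> (forall k, `|h k| <= b) ->
  `|\sum_k A j k * h k| <= weight A * b.
Proof.
move=> b0 hb; apply: le_trans (ler_norm_sum _ _ _) _.
apply: (@le_trans _ _ (\sum_k `|A j k| * b)).
  by apply: ler_sum => k _; rewrite normrM ler_wpM2l.
rewrite -mulr_suml ler_wpM2r// /weight [X in _ <= X](bigD1 j)//= lerDl.
by apply: sumr_ge0 => i _; apply: sumr_ge0.
Qed.

Lemma kuramoto_lipschitz A (x y : 'I_n -> R) (d : R) :
  (forall j, `|x j - y j| <= d) ->
  forall j, `|kuramoto A x j - kuramoto A y j| <= (2 * weight A + 1) * d.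
Proof.
move=> xy j; have d0 : 0 <= d by apply: le_trans (xy j).
rewrite /kuramoto -sumrB.
under eq_bigr do rewrite -mulrBr.
have d20 : 0 <= 2 * d by rewrite mulr_ge0.
have H k : `|sin (x k - x j) - sin (y k - y j)| <= 2 * d.
  apply: le_trans (sin_lipschitz _ _) _.
  have := xy j; have := xy k; rewrite !ler_norml; lra.
apply: le_trans (row_weight A j d20 H) _.
by have := mulr_ge0 (weight_ge0 A) d0; lra.
Qed.

(** Its Laplacian is the Hessian of the energy, that is, minus the Jacobian of
    the vector field. *)
Definition linearization A theta : 'M[R]_n :=
  \matrix_(j, k) (A j k * cos (theta k - theta j)).

Lemma linearization_sym A theta : A^T = A ->
  (linearization A theta)^T = linearization A theta.
Proof.
move=> sA; apply/matrixP => j k; rewrite !mxE (sym_entry k j sA) -cosN.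
by congr (_ * cos _); rewrite opprB.
Qed.

(** Taylor expansion of each coupling term.  The terms of order 0 add up to 0
    because [theta] is an equilibrium, and each remainder is at most
    [3 * (u k - u j) ^+ 2 <= 12 * dot u u]. *)
Lemma kuramoto_linearized A theta (u : 'I_n -> R) j : equilibrium A theta ->
  `|kuramoto A (theta \+ u) j + mxapp (lapmx (linearization A theta)) u j|
    <= weight A * (12 * dot u u).
Proof.
move=> eq; rewrite -[X in `|X|]subr0 -{1}(eq j) mxapp_lapmx -big_split -sumrB.
rewrite (eq_bigr (fun k => A j k * (sin ((theta k - theta j) + (u k - u j))
   - sin (theta k - theta j) - cos (theta k - theta j) * (u k - u j)))); last first.
  move=> k _; rewrite mxE /= (_ : theta k + u k - (theta j + u j) = theta k - theta j + (u k - u j)); ring.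
apply: row_weight => [|k]; first by rewrite mulr_ge0// dot_ge0.
apply: le_trans (sin_taylor _ _) _.
have := sqr_le_dot u j; have := sqr_le_dot u k; have := sqr_ge0 (u k + u j); lra.
Qed.

(** With [B = H + s] as chosen below and [v = B u], the derivative of
    [V = - u^T B u] along a solution is [2 * |v| ^+ 2 + 2 * s * V - 2 * v^T rho],
    where [rho] is the remainder of second order.  As [|u|] is at most a multiple
    of [|v|], the remainder is absorbed by [|v| ^+ 2] near the equilibrium, and [V]
    grows at least like [expR (2 * s * t)]. *)
Lemma linear_instability A theta (x : 'I_n -> R) : A^T = A ->
  equilibrium A theta -> form (lapmx (linearization A theta)) x x < 0 ->
  ~ lyapunov_stable A theta.
Proof.
move=> sA eq; set H := lapmx _; set q := form H x x => q0 stab.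
have sH : H^T = H by apply: lapmx_sym; exact: linearization_sym.
have dx : 0 < dot x x.
  rewrite lt_def dot_ge0 andbT; apply: contraTneq q0 => x0.
  rewrite -leNgt /q [form _ _ _]big1// => j _; rewrite (dot_eq0 x0) mul0r//.
have [s [s0 sq uB]] : exists s : R, [/\ 0 < s, s <= - q / (2 * dot x x) & s%:M + H \in unitmx].
  by apply: nonsingular_shift => //; rewrite divr_gt0 ?oppr_gt0 ?mulr_gt0.
set B := s%:M + H in uB.
have sB : B^T = B by rewrite /B linearD /= sH tr_scalar_mx.
have Bx : form B x x < 0.
  rewrite /B formDM form_scalar -/q.
  by move: sq; rewrite ler_pdivlMr ?mulr_gt0//; lra.
have [K K0 HK] := unitmx_lower_bound uB.
have [K' K'0 HK'] := form_upper (- B).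
set T := weight A; have T0 : 0 <= T := weight_ge0 A.
pose X := n%:R * (12 * T) ^+ 2 * n%:R * K.
have X0 : 0 <= X by rewrite !mulr_ge0 ?sqr_ge0.
(* Chosen so that [eps * X <= 1] and [eps <= 1]; then the remainder, whose
   square norm is at most [eps ^+ 2 * X * |v| ^+ 2], is dominated by [v]. *)
pose eps := 1 / (1 + X).
have X1 : 0 < 1 + X by rewrite ltr_pwDl.
have e0 : 0 < eps by rewrite divr_gt0.
have eX : eps * (1 + X) = 1 by rewrite /eps divfK ?gt_eqF.
have e1 : eps <= 1 by rewrite ler_pdivrMr// mul1r lerDl.
have [d d0 Hd] := stab eps e0.
(* The starting point is [theta + c x]. *)
pose c := Num.min d eps / (1 + dot x x).
have dx1 : 0 < 1 + dot x x by rewrite ltr_pwDl// ltW.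
have c0 : 0 < c by rewrite divr_gt0// lt_min d0 e0.
have cx j : `|c * x j| < Num.min d eps.
  rewrite normrM gtr0_norm// /c mulrAC ltr_pdivrMr//.
  rewrite ltr_pM2l ?lt_min ?d0 ?e0//.
  have := sqr_le_dot x j; rewrite -[x j ^+ 2]real_normK ?num_real//.
  have := sqr_ge0 (`|x j| - 1); lra.
have L0 : 0 < 2 * T + 1 by rewrite ltr_wpDl// mulr_ge0.
have [y [y0 Dy]] := ode_exists L0 (@kuramoto_lipschitz A) (theta \+ (c \*o x)).
pose u t j := y t j - theta j.
have u0 j : u 0 j = c * x j by rewrite /u y0 /= addrAC subrr add0r.
have yE t : theta \+ u t = y t by apply/funext => j; rewrite /= /u addrC subrK.
have Du (t : R) j : 0 <= t -> is_derive t 1 (fun s => u s j) (kuramoto A (y t) j).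
  move=> t0; rewrite -[kuramoto _ _ _]subr0; apply: is_deriveB; exact: Dy.
have sol : kuramoto_solution A y.
  move=> j; split; last by move=> t /ltW t0; exact: Dy.
  apply: continuous_in_subspaceT => t; rewrite inE /= in_itv /= andbT => t0.
  exact: is_derive_continuous (Dy t j t0).
have close0 : phase_close d (y 0) theta.
  move=> j; exists 0; rewrite mul0r subr0 -/(u 0 j) u0.
  by apply: lt_le_trans (cx j) _; rewrite ge_min lexx.
have small (t : R) j : 0 <= t -> `|u t j| < eps.
  move=> t0; apply: (@stays_near_lift (fun t => u t j) eps t) => //.
  - apply: continuous_within => r /andP[r0 _].
    exact: is_derive_continuous (Du r j r0).
  - by rewrite u0; apply: lt_le_trans (cx j) _; rewrite ge_min lexx orbT.
  - by move=> r /andP[r0 _]; exact: Hd sol close0 r r0 j.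
have dotu (t : R) : 0 <= t -> dot (u t) (u t) <= n%:R * eps ^+ 2.
  move=> t0; rewrite mulr_natl -[X in _ *+ X]card_ord -sumr_const; apply: ler_sum => j _.
  by rewrite -expr2 -[X in X <= _]real_normK ?num_real// ler_sqr ?nnegrE ?(ltW e0)// ltW ?small.
pose V t := form (- B) (u t) (u t).
pose dV t := - (2 * dot (mxapp B (u t)) (kuramoto A (y t))).
have DV (t : R) : 0 <= t -> is_derive t 1 V (dV t).
  move=> t0; have := is_derive_form (- B) (fun j => Du t j t0).
  rewrite !formNM [form B (kuramoto _ _) _]dotC [form B (u t) _]formC// -/(dot _ _).
  rewrite [form B (kuramoto _ _) _]dotC.
  by rewrite -opprD -mulr2n -mulr_natl.
have dVge (t : R) : 0 <= t -> 2 * s * V t <= dV t.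
  move=> t0; set v := mxapp B (u t).
  pose rho j := kuramoto A (y t) j + mxapp H (u t) j.
  have uv : dot v (u t) = - V t by rewrite dotC /V formNM opprK.
  have rhoE : kuramoto A (y t) = rho \- (v \- (s \*o u t)).
    by apply/funext => j; rewrite /rho /v /B mxappDM mxapp_scalar /=; ring.
  have rr : dot rho rho <= dot v v.
    (* One factor [|u| ^+ 2] is bounded by [n * eps ^+ 2], the other by [K * |v| ^+ 2]. *)
    have D0 := dot_ge0 (u t); have D1 := dotu t t0; have D2 := HK (u t); rewrite -/v in D2.
    have R1 : dot rho rho <= n%:R * (T * (12 * dot (u t) (u t))) ^+ 2.
      rewrite mulr_natl -[X in _ *+ X]card_ord -sumr_const; apply: ler_sum => j _.
      rewrite -expr2 -[X in X <= _]real_normK ?num_real// ler_sqr ?nnegrE ?mulr_ge0//.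
      by rewrite /rho -yE; exact: kuramoto_linearized.
    apply: le_trans R1 _.
    have -> : n%:R * (T * (12 * dot (u t) (u t))) ^+ 2 =
      (n%:R * (12 * T) ^+ 2) * (dot (u t) (u t) * dot (u t) (u t)) by ring.
    have v0 := dot_ge0 v.
    have R2 : dot (u t) (u t) * dot (u t) (u t) <= (n%:R * eps ^+ 2) * (K * dot v v).
      by apply: ler_pM.
    apply: le_trans (ler_wpM2l (_ : 0 <= n%:R * (12 * T) ^+ 2) R2) _.
      by rewrite mulr_ge0 ?sqr_ge0.
    have -> : n%:R * (12 * T) ^+ 2 * (n%:R * eps ^+ 2 * (K * dot v v)) = eps * (eps * X) * dot v v.
      by rewrite /X; ring.
    rewrite ler_piMl//.
    have eX1 : eps * X <= 1 by lra.
    have eX0 : 0 <= eps * X by rewrite mulr_ge0// ltW.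
    by rewrite mulr_ile1// ltW.
  rewrite /dV rhoE -/v !dotBr dotZr uv.
  have := dot_le_half v rho; lra.
(* [V' >= 2 s V] says that this function does not decrease. *)
pose Z t := expR (- (2 * s) * t) * V t.
have expD (t : R) := is_derive_exp_linear 1 (- (2 * s)) t.
have DZ (t : R) : 0 <= t -> is_derive t 1 Z
    (expR (- (2 * s) * t) * dV t + V t * (- (2 * s) * expR (- (2 * s) * t))).
  move=> t0; have := expD t; under eq_fun do rewrite mul1r.
  rewrite mul1r => E; have DVt := DV t t0.
  exact: is_deriveM.
have Zmono (t : R) : 0 <= t -> V 0 <= Z t.
  move=> t0; have -> : V 0 = Z 0 by rewrite /Z mulr0 expR0 mul1r.
  apply: (@le_of_derive_ge0 R Z (fun t => expR (- (2 * s) * t) * dV t + V t * (- (2 * s) * expR (- (2 * s) * t)))).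
  - exact: t0.
  - by apply: continuous_within => r /andP[r0 _]; exact: is_derive_continuous (DZ r r0).
  - by move=> r /andP[/ltW r0 _]; exact: DZ.
  - move=> r /andP[/ltW r0 _].
    have -> : expR (- (2 * s) * r) * dV r + V r * (- (2 * s) * expR (- (2 * s) * r)) =
       expR (- (2 * s) * r) * (dV r - 2 * s * V r) by ring.
    by rewrite mulr_ge0 ?expR_ge0// subr_ge0 dVge.
have V0 : 0 < V 0.
  rewrite /V (_ : u 0 = c \*o x); last by apply/funext.
  rewrite formNM formZr formC// formZr oppr_gt0 mulrA pmulr_rlt0//; exact: mulr_gt0.
pose b := K' * (n%:R * eps ^+ 2).
have b0 : 0 <= b by rewrite mulr_ge0// mulr_ge0// sqr_ge0.
have Vb (t : R) : 0 <= t -> V t <= b.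
  by move=> t0; apply: le_trans (HK' (u t)) _; rewrite ler_wpM2l// dotu.
(* At this time the lower bound [V 0 * (1 + 2 * s * t)] exceeds [b]. *)
pose t := b / (2 * s * V 0).
have sV : 0 < 2 * s * V 0 by rewrite !mulr_gt0.
have t0 : 0 <= t by rewrite divr_ge0// ltW.
have := Zmono t t0; rewrite /Z mulNr expRN mulrC ler_pdivlMr ?expR_gt0//.
move=> Hc; have := Vb t t0.
have tE : t * (2 * s * V 0) = b by rewrite divfK ?gt_eqF.
have := ler_wpM2l (ltW V0) (expR_ge1Dx (2 * s * t)); lra.
Qed.

Lemma stable_curvature A theta : A^T = A -> equilibrium A theta ->
  lyapunov_stable A theta -> curvature_nonneg A theta.
Proof.
move=> sA eq stab x; rewrite leNgt; apply/negP => neg.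
apply: (@linear_instability A theta x) => //.
have := form_lapmx_diff x (linearization_sym theta sA).
rewrite [X in _ = X](_ : _ = \sum_j \sum_k A j k * cos (theta k - theta j) * (x j - x k) ^+ 2).
  by move=> E; move: neg; rewrite -E; lra.
by apply: eq_bigr => j _; apply: eq_bigr => k _; rewrite mxE.
Qed.

End Instability.

(** * Rotating the phases *)

Section Rotation.
Variables (R : realType) (n : nat) (A : 'M[R]_n).
Implicit Types (theta : 'I_n -> R) (phi : R).

Lemma equilibrium_rotate theta phi :
  equilibrium A theta -> equilibrium A (fun j => theta j - phi).
Proof.
by move=> eq j; rewrite -(eq j); apply: eq_bigr => k _; congr (_ * sin _); ring.
Qed.

Lemma curvature_rotate theta phi :
  curvature_nonneg A theta -> curvature_nonneg A (fun j => theta j - phi).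
Proof.
move=> C x; apply: le_trans (C x) _; rewrite le_eqVlt; apply/orP; left; apply/eqP.
by apply: eq_bigr => j _; apply: eq_bigr => k _; congr (_ * cos _ * _); ring.
Qed.

Lemma centring_phase theta : exists phi : R,
  \sum_j sin (theta j - phi) = 0 /\ 0 <= \sum_j cos (theta j - phi).
Proof.
have [phi E P] := polar (\sum_j cos (theta j)) (\sum_j sin (theta j)).
exists phi; split.
  under eq_bigr do rewrite sinB.
  by rewrite sumrB -!mulr_suml E subrr.
under eq_bigr do rewrite cosB.
by rewrite big_split -!mulr_suml.
Qed.
End Rotation.

Theorem theorem11 (R : realType) (n : nat) (e : rel 'I_n) (p : R)
    (e_sym : symmetric e) (p_gt0 : 0 < p) (p_lt1 : p < 1)
    (A := adjmx R e) (L := lapmx A)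
    (nA := spectral_norm (DeltaA p A)) (nL := spectral_norm (DeltaL p L))
    (hi : nA / (n%:R * p) < 1 / 12)
    (hii : nL / (n%:R * p) < 1 / 4)
    (nL_neq0 : nL != 0)
    (asin_neq0 : asin (12 * nA / (n%:R * p)) != 0)
    (ln_neq0 : ln (n%:R * p / (2 * nL) - 1) != 0)
    (hiii : (pi / 4) / asin (12 * nA / (n%:R * p)) >
            ln (n%:R / 6) / ln (n%:R * p / (2 * nL) - 1) + 1) :
  forall theta : 'I_n -> R,
    equilibrium A theta /\ lyapunov_stable A theta <-> all_in_phase theta.
Proof.
move=> theta.
have nL0 : 0 <= nL := spectral_norm_ge0 _.
have nLp : 0 < nL by rewrite lt_def nL_neq0 nL0.
have nA0 : 0 <= nA := spectral_norm_ge0 _.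
have n0 : (0 < n)%N.
  rewrite lt0n; apply: contra_neq nL_neq0 => n0; rewrite /nL /spectral_norm.
  set S := (X in sup X); suff -> : S = set0 by rewrite sup0.
  rewrite -subset0 => _ [b /= /eigenvalueP[v _ /eqP v0] _]; apply: v0.
  by apply/rowP => -[i iP]; exfalso; rewrite n0 in iP.
have np0 : 0 < n%:R * p by rewrite mulr_gt0// ltr0n.
set x := 12 * nA / (n%:R * p) in hiii asin_neq0.
have x0 : 0 <= x by rewrite divr_ge0 ?mulr_ge0// ltW.
have x1 : x < 1.
  by move: hi; rewrite ltr_pdivrMr// ltr_pdivrMr//; lra.
have xI : -1 <= x <= 1 by lra.
have sin_asin : sin (asin x) = x by rewrite asinK// in_itv.
have pi0 := pi_gt0 R.
have al2 : asin x <= pi / 2 by exact: asin_lepi2.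
have al0 : 0 < asin x.
  rewrite lt_def asin_neq0 /= leNgt; apply/negP => neg.
  have := asin_geNpi2 xI => lo.
  have : 0 < sin (- asin x) by apply: sin_gt0_pi; lra.
  by rewrite sinN sin_asin; lra.
have nAp : 0 < nA.
  rewrite lt_def nA0 andbT; apply: contra_neq asin_neq0 => z.
  have xz : x = 0 by rewrite /x z mulr0 mul0r.
  rewrite xz -{1}(@sin0 R) sinK// in_itv /=; lra.
have aE : n%:R * p * sin (asin x) = 12 * nA.
  by rewrite sin_asin /x mulrC divfK// gt_eqF.
have sA : A^T = A by apply/matrixP => j k; rewrite !mxE e_sym.
have A0 j k : 0 <= A j k by rewrite mxE ler0n.
split; last by move=> th; split; [exact: all_in_phase_equilibrium | exact: all_in_phase_stable].
move=> [eq stab]; have curv := stable_curvature sA eq stab.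
have [phi [sz cz]] := centring_phase theta.
have a_lt : 12 * nA < n%:R * p by move: x1; rewrite ltr_pdivrMr// mul1r.
have l_lt : 4 * nL < n%:R * p by rewrite -ltr_pdivlMl// -[4^-1]mul1r -ltr_pdivrMr.
set g := n%:R * p / (2 * nL) - 1 in hiii ln_neq0.
have gE : 2 * nL * (g + 1) = n%:R * p.
  by rewrite /g subrK mulrC divfK// mulf_neq0// gt_eqF.
have g1 : 1 < g.
  rewrite /g ltrBrDr (ltr_pdivlMr _ _ (mulr_gt0 (ltr0Sn R 1) nLp)).
  by have -> : (1 + 1) * (2 * nL) = 4 * nL by ring.
have eqr := equilibrium_rotate phi eq.
have cr := curvature_rotate phi curv.
have cos_gt0 := far_eventually_empty sA A0 p_gt0 n0 sz cz eqr cr nAp a_lt al0 al2 aE nLp g1.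
have {}cos_gt0 := cos_gt0 (eq_ind_r (fun z => z <= _) (lexx _) gE) hiii.
have ph := in_phase_of_cos_gt0 sA A0 n0 eqr l_lt cos_gt0.
move=> j k; have [m E] := ph j k; exists m; rewrite -E; ring.
Qed.
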